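(* Every strictly non-expanding $*$-algebra $A$ has a faithful $*$-representation by unbounded operators; that is, there exist a pre-Hilbert space $E$ and an injective $*$-homomorphism from $A$ into the $*$-algebra $L(E)$ of (not necessarily bounded) linear operators on $E$.
   Context: Words and order. $F_*=\mathbb{C}\langle x_1,\dots,x_m,x_1^*,\dots,x_m^*\rangle$ is the free associative algebra with involution given on generators by $x_j\mapsto x_j^*$; $W$ is the semigroup of all words (including the empty word) in the $2m$ generators, and $|w|$ is the length of $w$. A linear order on the generators is fixed, and words are ordered degree-lexicographically: longer words are greater, words of the same length are compared lexicographically. For words, $\sup(u,v)$ is the greater of $u,v$. For $f=\sum_{w\in W}f(w)w\in F_*$ and $z\in W$ write $z\prec f$ iff $f(z)\neq0$. For $f\ne0$, $\hat f$ is the greatest word $w$ with $w\prec f$, and $\deg f=|\hat f|$. Compositions. $f,g\in F_*$ form a composition $w\in W$ if $w=\hat f w_1=w_2\hat g$ for nonempty words $w_1,w_2$ with $|\hat f|>|w_2|$; its result is $(f,g)_w=\beta f w_1-\alpha w_2 g$, where $\alpha,\beta$ are the coefficients of $\hat f,\hat g$ in $f,g$. A subset $S\subseteq F_*$ is closed under compositions if for all $f,g\in S$: (1) if $f\ne g$, then $\hat f$ is not a subword of $\hat g$; (2) if $f,g$ form a composition $w$, then $(f,g)_w=\sum_{j}\alpha_j a_jf_jb_j$ (finite sum) with $\alpha_j\in\mathbb{C}$, $a_j,b_j\in W$, $f_j\in S$, and the greatest word of each $a_jf_jb_j$ is less than $w$. For such $S$, let $\mathcal I$ be the two-sided ideal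 generated by $S$ and $BW$ the set of words containing no $\hat s$ ($s\in S$) as a subword. The images of $BW$ form a linear basis of $F_*/\mathcal I$. Let $\mathrm R_S$ be the linear map sending $f\in F_*$ to the unique element of the linear span of $BW$ congruent to $f$ modulo $\mathcal I$. A set $S$ closed under compositions and generating $\mathcal I$ is called a Gröbner basis of $F_*/\mathcal I$. Non-expanding sets and algebras. $S\subseteq F_*$ is symmetric if the ideal $\mathcal I$ generated by $S$ is closed under the involution. A symmetric $S$ closed under compositions is non-expanding if for all $u,v,w\in BW$ with $u\neq v$ and $ww^*\prec \mathrm R_S(uv^* )$ one has $w<\sup(u,v)$; it is strictly non-expanding if in addition $dd^*\in BW$ for every $d\in BW$. A (finitely generated) $*$-algebra $A$ is strictly non-expanding if it possesses a strictly non-expanding Gröbner basis, i.e. $A\cong F_*/\mathcal I$ as $*$-algebras, where $\mathcal I$ is generated by some strictly non-expanding $S\subseteq F_*$ (for some choice of finitely many ordered generators). For a pre-Hilbert space $E$, $L(E)$ is the $*$-algebra of linear operators $E\to E$ possessing an adjoint $E\to E$. *)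

(* Defs.v *)
From HB Require Import structures.
From mathcomp Require Import all_boot all_order all_algebra.
From mathcomp Require Import generic_quotient.
From mathcomp Require Import boolp classical_sets reals.
From mathcomp Require Import complex.
From mathcomp Require Import finmap monalg.

Set Implicit Arguments.
Unset Strict Implicit.
Unset Printing Implicit Defensive.

Import Order.TTheory GRing.Theory Num.Theory Num.Def.

Local Open Scope ring_scope.
Local Open Scope quotient_scope.
Local Open Scope classical_set_scope.

(* Unital complex *-algebras, the zero algebra included: the quotient of a free
   *-algebra by the ideal generated by the empty word is zero, and so is L(E)
   for E = 0.  The library's algType excludes the zero ring and no structure
   can join pzRingType with lmodType besides it, hence the scaling by complex
   numbers is an operation of its own, cscale, which is *: whenever the carrier
   also has an lmodType structure. *)
HB.mixin Record isStarAlgebra (C : numClosedFieldType) A of GRing.PzRing A := {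
  cscale : C -> A -> A;
  cscaleA : forall (c d : C) (a : A), cscale c (cscale d a) = cscale (c * d) a;
  cscale1 : left_id 1 cscale;
  cscaleDr : right_distributive cscale +%R;
  cscaleDl : forall a : A, {morph cscale^~ a : c d / c + d};
  cscaleAl : forall (c : C) (a b : A), cscale c (a * b) = cscale c a * b;
  cscaleAr : forall (c : C) (a b : A), cscale c (a * b) = a * cscale c b;
  star : A -> A;
  starK : involutive star;
  starD : {morph star : a b / a + b};
  starZ : forall (c : C) (a : A), star (cscale c a) = cscale c^* (star a);
  starM : forall a b : A, star (a * b) = star b * star a
}.

#[short(type="starAlgType")]
HB.structure Definition StarAlgebra (C : numClosedFieldType) :=
  {A of GRing.PzRing A & isStarAlgebra C A}.

Arguments cscale {C s} c a.
Arguments star {C s} a.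

Section StarMorphisms.
Variables (C : numClosedFieldType) (A B : starAlgType C).

Record is_star_morphism (f : A -> B) : Prop := IsStarMorphism {
  star_morphD : {morph f : a b / a + b};
  star_morphZ : forall c : C, {morph f : a / cscale c a};
  star_morphM : {morph f : a b / a * b};
  star_morph1 : f 1 = 1;
  star_morph_star : forall a, f (star (a : A)) = star (f a)
}.

Definition star_isomorphic : Prop :=
  exists2 f : A -> B, is_star_morphism f & bijective f.

End StarMorphisms.

Section StarTheory.
Variables (C : numClosedFieldType) (A : starAlgType C).
Implicit Types a b : A.

Lemma cscaleBr (c : C) a b : cscale c (a - b) = cscale c a - cscale c b.
Proof. by apply/eqP; rewrite eq_sym subr_eq -cscaleDr subrK. Qed.

Lemma star0 : star (0 : A) = 0.
Proof. by apply: (addrI (star 0)); rewrite -starD !addr0. Qed.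

Lemma starN a : star (- a) = - star a.
Proof. by apply: (addrI (star a)); rewrite -starD !subrr star0. Qed.

Lemma starB a b : star (a - b) = star a - star b.
Proof. by rewrite starD starN. Qed.

End StarTheory.

Section Ideals.
Variables (C : numClosedFieldType) (A : starAlgType C).

Record two_sided_ideal (I : set A) : Prop := TwoSidedIdeal {
  tsi0 : I 0;
  tsiB : forall a b, I a -> I b -> I (a - b);
  tsiMl : forall a b, I b -> I (a * b);
  tsiMr : forall a b, I a -> I (a * b)
}.

Record star_ideal := StarIdeal {
  star_ideal_set :> A -> Prop;
  star_ideal_tsi : two_sided_ideal star_ideal_set;
  star_ideal_star : forall a, star_ideal_set a -> star_ideal_set (star a)
}.

Definition ideal_gen (S : set A) : set A :=
  [set a | forall I : set A, two_sided_ideal I -> S `<=` I -> I a].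

Lemma ideal_gen_tsi S : two_sided_ideal (ideal_gen S).
Proof.
split=> [I /tsi0//|a b Ia Ib I tI sI|a b Ib I tI sI|a b Ia I tI sI].
- exact: (tsiB tI (Ia I tI sI) (Ib I tI sI)).
- exact: (tsiMl tI a (Ib I tI sI)).
- exact: (tsiMr tI b (Ia I tI sI)).
Qed.

End Ideals.

Section Quotient.
Variables (C : numClosedFieldType) (A : starAlgType C) (I : star_ideal A).
Implicit Types (a b : A) (c : C).

Let tI := star_ideal_tsi I.

Definition ideal_equiv : rel A := fun a b => `[< I (a - b) >].

Lemma ideal_equivP a b : reflect (I (a - b)) (ideal_equiv a b).
Proof. exact: asboolP. Qed.

Lemma tsiN a : I a -> I (- a).
Proof. by move=> Ia; rewrite -sub0r; apply: (tsiB tI) (tsi0 tI) Ia. Qed.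

Lemma tsiD a b : I a -> I b -> I (a + b).
Proof. by move=> Ia Ib; rewrite -[b]opprK; apply: (tsiB tI) Ia (tsiN Ib). Qed.

Lemma ideal_equiv_refl : reflexive ideal_equiv.
Proof. by move=> a; apply/ideal_equivP; rewrite subrr; apply: tsi0 tI. Qed.

Lemma ideal_equiv_sym : symmetric ideal_equiv.
Proof.
by move=> a b; apply/ideal_equivP/ideal_equivP => /tsiN; rewrite opprB.
Qed.

Lemma ideal_equiv_trans : transitive ideal_equiv.
Proof.
move=> b a d /ideal_equivP ab /ideal_equivP bd; apply/ideal_equivP.
by have := tsiD ab bd; rewrite addrA subrK.
Qed.

Canonical ideal_equiv_rel :=
  EquivRel ideal_equiv ideal_equiv_refl ideal_equiv_sym ideal_equiv_trans.

Definition star_quot := {eq_quot ideal_equiv_rel}.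

HB.instance Definition _ := Choice.on star_quot.

Definition quot_pi (a : A) : star_quot := \pi_{eq_quot ideal_equiv_rel} a.

Let rp (q : star_quot) : A := repr (q : {eq_quot ideal_equiv_rel}).

Lemma quot_piK (q : star_quot) : quot_pi (rp q) = q.
Proof. exact: reprK. Qed.

Lemma quot_piP a b : quot_pi a = quot_pi b <-> I (a - b).
Proof.
rewrite /quot_pi; split=> [/eqmodP/ideal_equivP//|Iab].
by apply/eqmodP/ideal_equivP.
Qed.

Lemma rp_pi a : I (rp (quot_pi a) - a).
Proof. by apply/quot_piP; rewrite quot_piK. Qed.

Let qadd (p q : star_quot) := quot_pi (rp p + rp q).
Let qopp (p : star_quot) := quot_pi (- rp p).
Let qmul (p q : star_quot) := quot_pi (rp p * rp q).
Let qscale c (p : star_quot) := quot_pi (cscale c (rp p)).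
Let qstar (p : star_quot) := quot_pi (star (rp p)).

Let tsiZ c a : I a -> I (cscale c a).
Proof.
by move=> Ia; rewrite -[a]mul1r cscaleAl; apply: (tsiMl tI).
Qed.

Let piD a b : qadd (quot_pi a) (quot_pi b) = quot_pi (a + b).
Proof.
by apply/quot_piP; rewrite opprD addrACA; apply: tsiD; apply: rp_pi.
Qed.

Let piN a : qopp (quot_pi a) = quot_pi (- a).
Proof. by apply/quot_piP; rewrite -opprD; apply: tsiN; apply: rp_pi. Qed.

Let piM a b : qmul (quot_pi a) (quot_pi b) = quot_pi (a * b).
Proof.
apply/quot_piP; set a' := rp _; set b' := rp _.
have -> : a' * b' - a * b = (a' - a) * b' + a * (b' - b).
  by rewrite mulrBl mulrBr addrA subrK.
apply: tsiD; first by apply: (tsiMr tI); apply: rp_pi.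
by apply: (tsiMl tI); apply: rp_pi.
Qed.

Let piZ c a : qscale c (quot_pi a) = quot_pi (cscale c a).
Proof. by apply/quot_piP; rewrite -cscaleBr; apply: tsiZ; apply: rp_pi. Qed.

Let piS a : qstar (quot_pi a) = quot_pi (star a).
Proof.
by apply/quot_piP; rewrite -starB; apply: star_ideal_star; apply: rp_pi.
Qed.

Let quotW (P : star_quot -> Prop) : (forall a, P (quot_pi a)) -> forall q, P q.
Proof. by move=> Pa q; rewrite -(quot_piK q). Qed.

Let qaddA : associative qadd.
Proof.
by elim/quotW=> a; elim/quotW=> b; elim/quotW=> d; rewrite !piD addrA.
Qed.

Let qaddC : commutative qadd.
Proof. by elim/quotW=> a; elim/quotW=> b; rewrite !piD addrC. Qed.

Let qadd0 : left_id (quot_pi 0) qadd.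
Proof. by elim/quotW=> a; rewrite !piD add0r. Qed.

Let qaddN : left_inverse (quot_pi 0) qopp qadd.
Proof. by elim/quotW=> a; rewrite piN piD addNr. Qed.

HB.instance Definition _ :=
  GRing.isZmodule.Build star_quot qaddA qaddC qadd0 qaddN.

Let qmulA : associative qmul.
Proof.
by elim/quotW=> a; elim/quotW=> b; elim/quotW=> d; rewrite !piM mulrA.
Qed.

Let qmul1 : left_id (quot_pi 1) qmul.
Proof. by elim/quotW=> a; rewrite !piM mul1r. Qed.

Let q1mul : right_id (quot_pi 1) qmul.
Proof. by elim/quotW=> a; rewrite !piM mulr1. Qed.

Let qmulDl : left_distributive qmul +%R.
Proof.
elim/quotW=> a; elim/quotW=> b; elim/quotW=> d.
by rewrite [LHS](congr1 (qmul^~ _) (piD _ _)) !piM mulrDl -piD.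
Qed.

Let qmulDr : right_distributive qmul +%R.
Proof.
elim/quotW=> a; elim/quotW=> b; elim/quotW=> d.
by rewrite [LHS](congr1 (qmul _) (piD _ _)) !piM mulrDr -piD.
Qed.

HB.instance Definition _ := GRing.Zmodule_isPzRing.Build star_quot
  qmulA qmul1 q1mul qmulDl qmulDr.

Let qscaleA c d q : qscale c (qscale d q) = qscale (c * d) q.
Proof. by elim/quotW: q => a; rewrite !piZ cscaleA. Qed.

Let qscale1 : left_id 1 qscale.
Proof. by elim/quotW=> a; rewrite !piZ cscale1. Qed.

Let qscaleDr : right_distributive qscale +%R.
Proof.
move=> c; elim/quotW=> a; elim/quotW=> b.
by rewrite [LHS](congr1 (qscale c) (piD _ _)) !piZ cscaleDr -piD.
Qed.

Let qscaleDl q : {morph qscale^~ q : c d / c + d}.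
Proof. by elim/quotW: q => a c d; rewrite !piZ cscaleDl -piD. Qed.

Let qscalerAl c (p q : star_quot) : qscale c (p * q) = qscale c p * q.
Proof.
elim/quotW: p => a; elim/quotW: q => b.
by rewrite [LHS](congr1 (qscale c) (piM _ _)) !piZ cscaleAl -piM.
Qed.

Let qscalerAr c (p q : star_quot) : qscale c (p * q) = p * qscale c q.
Proof.
elim/quotW: p => a; elim/quotW: q => b.
by rewrite [LHS](congr1 (qscale c) (piM _ _)) !piZ cscaleAr -piM.
Qed.

Let qstarK : involutive qstar.
Proof. by elim/quotW=> a; rewrite !piS starK. Qed.

Let qstarD : {morph qstar : p q / p + q}.
Proof.
elim/quotW=> a; elim/quotW=> b.
by rewrite [LHS](congr1 qstar (piD _ _)) piS starD -piD -!piS.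
Qed.

Let qstarZ c (q : star_quot) : qstar (qscale c q) = qscale c^* (qstar q).
Proof. by elim/quotW: q => a; rewrite !(piS, piZ) starZ. Qed.

Let qstarM (p q : star_quot) : qstar (p * q) = qstar q * qstar p.
Proof.
elim/quotW: p => a; elim/quotW: q => b.
by rewrite [LHS](congr1 qstar (piM _ _)) piS starM -piM -!piS.
Qed.

HB.instance Definition _ := isStarAlgebra.Build C star_quot
  qscaleA qscale1 qscaleDr qscaleDl qscalerAl qscalerAr qstarK qstarD qstarZ qstarM.

Lemma quot_pi_star_morphism : is_star_morphism quot_pi.
Proof.
split=> [a b|c a|a b|//|a].
- exact: esym (piD a b).
- exact: esym (piZ c a).
- exact: esym (piM a b).
- exact: esym (piS a).
Qed.

End Quotient.

Section AdjointableOperators.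
Variables (C : numClosedFieldType) (E : lmodType C) (ip : {dot E for conjC}).
Implicit Types (f g : E -> E) (c : C).

Definition adjoint_of f g := forall x y, ip (f x) y = ip x (g y).

Record adjop := Adjop {
  adjop_fun :> E -> E;
  adjop_linear : linear adjop_fun;
  adjop_adjointable : exists2 g, linear g & adjoint_of adjop_fun g
}.

HB.instance Definition _ := gen_eqMixin adjop.
HB.instance Definition _ := gen_choiceMixin adjop.

Lemma adjopP (S T : adjop) : (forall x, S x = T x) -> S = T.
Proof.
case: S T => [f lf af] [g lg ag] /= /funext efg; rewrite {f}efg in lf af *.
by congr Adjop; apply: Prop_irrelevance.
Qed.

Lemma ip_inj x y : (forall z, ip z x = ip z y) -> x = y.
Proof.
move=> exy; apply/eqP; rewrite -subr_eq0; apply/negPn/negP.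
by move=> /(neq0_dnorm_gt0 (s := ip)); rewrite linearBr /= exy subrr ltxx.
Qed.

Lemma ipC x y : ip x y = (ip y x)^*.
Proof. by have := hermitian_subproof (s := ip) x y; rewrite expr0 mul1r. Qed.

Lemma adjoint_of_sym f g : adjoint_of f g -> adjoint_of g f.
Proof. by move=> fg x y; rewrite ipC -fg -ipC. Qed.

Definition adj_fun (T : adjop) : E -> E := s2val (cid2 (adjop_adjointable T)).

Lemma adj_funP (T : adjop) : adjoint_of T (adj_fun T).
Proof. exact: (s2valP' (cid2 (adjop_adjointable T))). Qed.

Lemma adj_fun_linear (T : adjop) : linear (adj_fun T).
Proof. exact: (s2valP (cid2 (adjop_adjointable T))). Qed.

Lemma adj_fun_uniq (T : adjop) f : adjoint_of T f -> adj_fun T =1 f.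
Proof. by move=> Tf x; apply: ip_inj => z; rewrite -Tf adj_funP. Qed.

Let linD f : linear f -> {morph f : x y / x + y}.
Proof. by move=> lf x y; rewrite -[x]scale1r lf !scale1r. Qed.

Let lin0 f : linear f -> f 0 = 0.
Proof.
by move=> lf; apply: (addrI (f 0)); rewrite -(linD lf) !addr0.
Qed.

Let linZ f : linear f -> forall c x, f (c *: x) = c *: f x.
Proof. by move=> lf c x; rewrite -[c *: x]addr0 lf lin0 // !addr0. Qed.

Fact adjop_zero_linear : linear (fun _ : E => 0 : E).
Proof. by move=> c x y; rewrite scaler0 addr0. Qed.
Fact adjop_zero_adj : adjoint_of (fun=> 0) (fun=> 0).
Proof. by move=> x y; rewrite linear0l linear0r. Qed.
Definition adjop_zero : adjop :=
  Adjop adjop_zero_linear (ex_intro2 _ _ _ adjop_zero_linear adjop_zero_adj).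

Fact adjop_one_linear : linear (@id E).
Proof. by []. Qed.
Fact adjop_one_adj : adjoint_of id id.
Proof. by []. Qed.
Definition adjop_one : adjop :=
  Adjop adjop_one_linear (ex_intro2 _ _ _ adjop_one_linear adjop_one_adj).

Fact add_linear f g : linear f -> linear g -> linear (fun x => f x + g x).
Proof. by move=> lf lg c x y; rewrite lf lg scalerDr addrACA. Qed.
Fact adjop_add_adj (S T : adjop) :
  adjoint_of (fun x => S x + T x) (fun x => adj_fun S x + adj_fun T x).
Proof. by move=> x y; rewrite linearDl linearDr /= !adj_funP. Qed.
Definition adjop_add (S T : adjop) : adjop :=
  Adjop (add_linear (@adjop_linear S) (@adjop_linear T))
    (ex_intro2 _ _ _ (add_linear (@adj_fun_linear S) (@adj_fun_linear T))
       (@adjop_add_adj S T)).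

Fact scale_linear c f : linear f -> linear (fun x => c *: f x).
Proof. by move=> lf d x y; rewrite lf scalerDr !scalerA mulrC. Qed.
Fact adjop_scale_adj c (T : adjop) :
  adjoint_of (fun x => c *: T x) (fun x => c^* *: adj_fun T x).
Proof. by move=> x y; rewrite linearZl_LR linearZr_LR /= conjCK adj_funP. Qed.
Definition adjop_scale c (T : adjop) : adjop :=
  Adjop (scale_linear c (@adjop_linear T))
    (ex_intro2 _ _ _ (scale_linear c^* (@adj_fun_linear T))
       (@adjop_scale_adj c T)).

Definition adjop_opp (T : adjop) : adjop := adjop_scale (-1) T.

Fact comp_linear f g : linear f -> linear g -> linear (fun x => f (g x)).
Proof. by move=> lf lg c x y; rewrite lg lf. Qed.
Fact adjop_comp_adj (S T : adjop) :
  adjoint_of (fun x => S (T x)) (fun x => adj_fun T (adj_fun S x)).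
Proof. by move=> x y; rewrite !adj_funP. Qed.
Definition adjop_comp (S T : adjop) : adjop :=
  Adjop (comp_linear (@adjop_linear S) (@adjop_linear T))
    (ex_intro2 _ _ _ (comp_linear (@adj_fun_linear T) (@adj_fun_linear S))
       (@adjop_comp_adj S T)).

Definition adjop_adj (T : adjop) : adjop :=
  Adjop (@adj_fun_linear T)
    (ex_intro2 _ _ _ (@adjop_linear T) (adjoint_of_sym (@adj_funP T))).

Let addA : associative adjop_add.
Proof. by move=> S T U; apply: adjopP => x /=; rewrite addrA. Qed.
Let addC : commutative adjop_add.
Proof. by move=> S T; apply: adjopP => x /=; rewrite addrC. Qed.
Let add0 : left_id adjop_zero adjop_add.
Proof. by move=> S; apply: adjopP => x /=; rewrite add0r. Qed.
Let addN : left_inverse adjop_zero adjop_opp adjop_add.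
Proof. by move=> S; apply: adjopP => x /=; rewrite scaleN1r addNr. Qed.

HB.instance Definition _ := GRing.isZmodule.Build adjop addA addC add0 addN.

Let mulA : associative adjop_comp.
Proof. by move=> S T U; apply: adjopP. Qed.
Let mul1 : left_id adjop_one adjop_comp.
Proof. by move=> S; apply: adjopP. Qed.
Let onemul : right_id adjop_one adjop_comp.
Proof. by move=> S; apply: adjopP. Qed.
Let mulDl : left_distributive adjop_comp +%R.
Proof. by move=> S T U; apply: adjopP. Qed.
Let mulDr : right_distributive adjop_comp +%R.
Proof. by move=> S T U; apply: adjopP => x /=; rewrite (linD (@adjop_linear S)). Qed.

HB.instance Definition _ :=
  GRing.Zmodule_isPzRing.Build adjop mulA mul1 onemul mulDl mulDr.

Let scaleA c d T : adjop_scale c (adjop_scale d T) = adjop_scale (c * d) T.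
Proof. by apply: adjopP => x /=; rewrite scalerA. Qed.
Let scale1 : left_id 1 adjop_scale.
Proof. by move=> S; apply: adjopP => x /=; rewrite scale1r. Qed.
Let scaleDr : right_distributive adjop_scale +%R.
Proof. by move=> c S T; apply: adjopP => x /=; rewrite scalerDr. Qed.
Let scaleDl T : {morph adjop_scale^~ T : c d / c + d}.
Proof. by move=> c d; apply: adjopP => x /=; rewrite scalerDl. Qed.

Let scaleAl c (S T : adjop) : adjop_scale c (S * T) = adjop_scale c S * T.
Proof. exact: adjopP. Qed.
Let scaleAr c (S T : adjop) : adjop_scale c (S * T) = S * adjop_scale c T.
Proof. by apply: adjopP => x /=; rewrite (linZ (@adjop_linear S)). Qed.
Let adjK : involutive adjop_adj.
Proof.
move=> T; apply: adjopP; apply: adj_fun_uniq.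
exact: adjoint_of_sym (adj_funP T).
Qed.
Let adjD : {morph adjop_adj : S T / S + T}.
Proof.
move=> S T; apply: adjopP; apply: adj_fun_uniq => x y.
by rewrite linearDl linearDr /= !adj_funP.
Qed.
Let adjZ c (T : adjop) : adjop_adj (adjop_scale c T) = adjop_scale c^* (adjop_adj T).
Proof.
apply: adjopP; apply: adj_fun_uniq => x y.
by rewrite linearZl_LR linearZr_LR /= conjCK adj_funP.
Qed.
Let adjM (S T : adjop) : adjop_adj (S * T) = adjop_adj T * adjop_adj S.
Proof.
by apply: adjopP; apply: adj_fun_uniq => x y; rewrite /= !adj_funP.
Qed.

HB.instance Definition _ := isStarAlgebra.Build C adjop
  scaleA scale1 scaleDr scaleDl scaleAl scaleAr adjK adjD adjZ adjM.

End AdjointableOperators.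

(* The generator x_j is (j, false) and x_j^* is (j, true). *)
Definition gen (m : nat) : Type := ('I_m * bool)%type.
HB.instance Definition _ m := Finite.on (gen m).

Definition gen_star m (x : gen m) : gen m := (x.1, ~~ x.2).

Definition word (m : nat) : Type := {fmonom gen m}.
HB.instance Definition _ m := MonomialDef.on (word m).

Definition seq_of_word m : word m -> seq (gen m) := @fmonom_val _.
Coercion seq_of_word : word >-> seq.

Definition word_star m (w : word m) : word m :=
  FMonom (rev [seq gen_star x | x <- w]).

Local Notation "1" := (@mone _) : monom_scope.
Local Notation "u * v" := (mmul u v) : monom_scope.

HB.lock Definition fstar (C : numClosedFieldType) (m : nat)
    (f : {malg C[word m]}) : {malg C[word m]} :=
  \sum_(w <- msupp f) << (f@_w)^* *g word_star w >>.

Section FreeStarMul.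
Variables (C : numClosedFieldType) (m : nat).
Local Notation F := {malg C[word m]}.
Local Notation fstar := (@fstar C m).
Implicit Types (f g : F) (u v w : word m) (c : C).

Lemma word_starK : involutive (@word_star m).
Proof.
move=> [s]; congr FMonom => /=; rewrite map_rev revK -map_comp map_id_in//.
by move=> [j b] _; rewrite /= /gen_star /= negbK.
Qed.

Lemma word_starM u v : word_star (u * v)%M = (word_star v * word_star u)%M.
Proof.
apply: val_inj; rewrite /= fmM /=.
by rewrite /seq_of_word fmM map_cat rev_cat.
Qed.

Lemma fstarE f w : (fstar f)@_w = (f@_(word_star w))^*.
Proof.
rewrite unlock raddf_sum /= (eq_bigr (fun v => (f@_v)^* *+ (v == word_star w))).
  have [wf|wf] := msuppP f (word_star w).
    rewrite (big_fsetD1 _ wf) /= eqxx mulr1n big_seq big1 ?addr0// => v.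
    by rewrite in_fsetD1 => /andP[/negPf->].
  rewrite conjC0 big_seq big1 // => v vf; case: eqVneq => // ev.
  by rewrite ev in vf; rewrite vf in wf.
by move=> v _; rewrite mcoeffU (can2_eq word_starK word_starK).
Qed.

Lemma fstarU c w : fstar << c *g w >> = << c^* *g word_star w >>.
Proof.
apply/malgP=> v; rewrite fstarE !mcoeffU rmorphMn /=.
by rewrite (can2_eq word_starK word_starK).
Qed.

Lemma fstarK : involutive fstar.
Proof. by move=> f; apply/malgP=> w; rewrite !fstarE word_starK conjCK. Qed.

Lemma fstarD : {morph fstar : f g / f + g}.
Proof.
move=> f g; apply/malgP=> w; rewrite fstarE.
rewrite (mcoeffD _ f g) (mcoeffD _ (fstar f) (fstar g)) rmorphD.
by rewrite (fstarE f) (fstarE g).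
Qed.

Lemma fstar0 : fstar 0 = 0.
Proof. by apply/malgP=> w; rewrite fstarE !mcoeff0 conjC0. Qed.

Lemma fstarZ c f : fstar (c *: f) = c^* *: fstar f.
Proof.
apply/malgP=> w; rewrite fstarE (mcoeffZ c f) (mcoeffZ _ (fstar f)) rmorphM.
by rewrite (fstarE f).
Qed.

Lemma malgMUU c d u v :
  (<< c *g u >> : F) * << d *g v >> = << c * d *g (u * v)%M >>.
Proof. exact: fgmulUU. Qed.

Lemma fstar_sum (I : Type) (r : seq I) (G : I -> F) :
  fstar (\sum_(i <- r) G i) = \sum_(i <- r) fstar (G i).
Proof. exact: (big_morph fstar fstarD fstar0). Qed.

Lemma fstarM f g : fstar (f * g) = fstar g * fstar f.
Proof.
rewrite [in LHS](monalgE f) [in RHS](monalgE f) mulr_suml !fstar_sum mulr_sumr.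
apply: eq_bigr => u _.
rewrite [in LHS](monalgE g) [in RHS](monalgE g) mulr_sumr !fstar_sum mulr_suml.
apply: eq_bigr => v _.
rewrite malgMUU !fstarU malgMUU rmorphM /= word_starM.
by rewrite [(f@_u)^* * _]mulrC.
Qed.

Lemma free_scalerAl c f g : c *: (f * g) = (c *: f) * g.
Proof. exact: scalerAl. Qed.

Lemma free_scalerAr c f g : c *: (f * g) = f * (c *: g).
Proof.
have cC : c%:MP * f = f * c%:MP.
  rewrite [LHS]fgmulUg [RHS]fgmulgU; apply: eq_bigr => k _.
  by rewrite mul1m mulm1 mulrC.
apply: etrans (esym (mul_malgC c (f * g))) _.
rewrite mulrA cC -mulrA; congr (f * _); exact: mul_malgC.
Qed.

End FreeStarMul.

Definition free_star (C : numClosedFieldType) (m : nat) : Type :=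
  {malg C[word m]}.
HB.instance Definition _ C m := GRing.Lalgebra.on (free_star C m).
HB.instance Definition _ C m := isStarAlgebra.Build C (free_star C m)
  (@scalerA _ _) (@scale1r _ _) (@scalerDr _ _) (@scalerDl _ _)
  (@free_scalerAl C m) (@free_scalerAr C m)
  (@fstarK C m) (@fstarD C m) (@fstarZ C m) (@fstarM C m).

Definition mon (C : numClosedFieldType) m (w : word m) : free_star C m :=
  << 1 *g w >>.

Definition linear_order (T : eqType) (le : rel T) : Prop :=
  [/\ reflexive le, antisymmetric le, transitive le & total le].

Section DegLex.
Variables (m : nat) (le : rel (gen m)).

Fixpoint lex_lt (s t : seq (gen m)) : bool :=
  match s, t with
  | x :: s', y :: t' => (x != y) && le x y || (x == y) && lex_lt s' t'
  | _, _ => false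
  end.

Definition word_lt (u v : word m) : bool :=
  (size u < size v)%N || (size u == size v) && lex_lt u v.

Definition word_sup (u v : word m) : word m := if word_lt u v then v else u.

End DegLex.

Section Groebner.
Variables (C : numClosedFieldType) (m : nat) (le : rel (gen m)).
Local Notation F := (free_star C m).
Local Notation "u <w v" := (word_lt le u v) (at level 70).
Implicit Types (f g : F) (u v w d : word m) (S : set F).

(* The empty word is the least word; lead 0 is a junk value. *)
Definition lead f : word m := \big[word_sup le/1%M]_(w <- msupp f) w.

Definition forms_composition f g w w1 w2 : Prop :=
  [/\ w = (lead f * w1)%M, w = (w2 * lead g)%M,
      w1 != 1%M, w2 != 1%M & (size w2 < size (lead f))%N].

Definition composition_result f g w1 w2 : F :=
  g@_(lead g) *: (f * mon C w1) - f@_(lead f) *: (mon C w2 * g).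

(* The terms of the sum are quadruples (alpha_j, a_j, f_j, b_j). *)
Definition reducible_below S w f : Prop :=
  exists2 s : seq (C * word m * F * word m),
    f = \sum_(t <- s) let: (alpha, a, h, b) := t in
          alpha *: (mon C a * h * mon C b)
    & forall alpha a h b, (alpha, a, h, b) \in s ->
        S h /\ lead (mon C a * h * mon C b) <w w.

(* Leading words being defined for nonzero elements only, the elements of S
   are required to be nonzero. *)
Definition closed_under_compositions S : Prop :=
  [/\ ~ S 0,
      forall f g, S f -> S g -> f != g -> ~~ infix (lead f) (lead g)
    & forall f g w w1 w2, S f -> S g -> forms_composition f g w w1 w2 ->
        reducible_below S w (composition_result f g w1 w2)].

Definition BW S : set (word m) :=
  [set w | forall s, S s -> ~~ infix (lead s) w].

Definition spanBW S : set F := [set f | forall w, f@_w != 0 -> BW S w].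

(* For S closed under compositions there is exactly one such element; xget
   selects it. *)
Definition RS S f : F :=
  xget 0 [set r | spanBW S r /\ ideal_gen S (f - r)].

Definition symmetric_set S : Prop :=
  forall f, ideal_gen S f -> ideal_gen S (star f).

Record non_expanding S : Prop := NonExpanding {
  ne_symmetric : symmetric_set S;
  ne_closed : closed_under_compositions S;
  ne_lt : forall u v w, BW S u -> BW S v -> BW S w -> u != v ->
    (RS S (mon C (u * word_star v)%M))@_(w * word_star w)%M != 0 ->
    w <w word_sup le u v
}.

Record strictly_non_expanding S : Prop := StrictlyNonExpanding {
  sne_non_expanding :> non_expanding S;
  sne_strict : forall d, BW S d -> BW S (d * word_star d)%M
}.

Definition sym_star_ideal S (symS : symmetric_set S) : star_ideal F :=
  StarIdeal (ideal_gen_tsi S) symS.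

End Groebner.

Definition strictly_non_expanding_algebra
    (C : numClosedFieldType) (A : starAlgType C) : Prop :=
  exists (m : nat) (le : rel (gen m)) (S : set (free_star C m))
         (hS : strictly_non_expanding le S),
    linear_order le /\
    star_isomorphic A (star_quot (sym_star_ideal (ne_symmetric hS))).

(* Main.v *)
Require Import Defs.
From HB Require Import structures.
From mathcomp Require Import all_boot all_order all_algebra.
From mathcomp Require Import boolp classical_sets reals.
From mathcomp Require Import complex.
From mathcomp Require Import finmap monalg.
From mathcomp Require Import zify ring.

(** The representation is a GNS representation, so it suffices to find on the
    quotient F/I of the free *-algebra F by the ideal I generated by S a linear
    functional T that commutes with the involutions and satisfies T(x x^* ) > 0
    for x <> 0 ([gns_representation]).

    By the composition (diamond) lemma ([spanBW_ideal0], [has_nf_mon]) every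
    element of F is congruent modulo I to a unique combination RS f of words of
    BW.  Given real weights a(w), let L(f) be the sum, over the words of the
    form w w^* occurring in RS f, of their coefficients times a(w), and put
    T(f) = L(f) + conj (L(f^* )).  The symmetrization makes T compatible with
    the involution, which L need not be since BW need not be closed under it;
    T vanishes on I because I is closed under the involution.

    For u in BW the word u u^* is in BW by strictness, so that
    T(u u^* ) = 2 a(u).  For distinct u and v in BW the non-expanding condition
    says that T(u v^* ) only depends on the weights a(w) of the words w smaller
    than sup(u, v) ([eq_gram]).  Words ordered degree-lexicographically embed in
    the natural numbers ([word_ltE]), so a can be defined recursively, each a(u)
    being so large that the Gram matrix T(u v^* ) is strictly dominated by its
    diagonal in the weighted sense of [diagonal_dominance]; it is then positive
    definite ([functional_gt0_nf]). *)

Set Implicit Arguments.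
Unset Strict Implicit.
Unset Printing Implicit Defensive.

Import Order.TTheory GRing.Theory Num.Theory Num.Def.

Local Open Scope ring_scope.
Local Notation "1" := (@mone _) : monom_scope.
Local Notation "u * v" := (mmul u v) : monom_scope.

(** * The degree-lexicographic order *)

Section Rank.
Variables (m : nat) (le : rel (gen m)).
Hypothesis le_lin : linear_order le.

(** The number of generators not greater than x: a digit between 1 and the number
    of generators, increasing in x. *)
Definition digit (x : gen m) : nat := #|[pred y | le y x]|.

(** The natural number written by the digits of s in bijective base
    #|{: gen m}|.  As there is no digit 0, longer sequences get greater numbers,
    and rank embeds the degree-lexicographic order in the natural numbers. *)
Fixpoint srank (s : seq (gen m)) : nat :=
  if s is x :: s' then (digit x * #|{: gen m}| ^ size s' + srank s')%N else 0.

Definition rank (w : word m) : nat := srank w.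

(** A lower bound of the ranks of the words of length n, reached when all the
    digits are 1. *)
Definition least_rank n : nat := (\sum_(i < n) #|{: gen m}| ^ i)%N.

Lemma least_rankS n : least_rank n.+1 = (least_rank n + #|{: gen m}| ^ n)%N.
Proof. by rewrite /least_rank big_ord_recr. Qed.

Lemma digit_gt0 x : (0 < digit x)%N.
Proof. by case: le_lin => r _ _ _; apply/card_gt0P; exists x; rewrite inE. Qed.

Lemma digit_lt x y : x != y -> le x y -> (digit x < digit y)%N.
Proof.
case: le_lin => r a t _ nxy lxy; apply: proper_card; apply/properP; split.
  by apply/fintype.subsetP => z; rewrite !inE => /t; apply.
exists y; rewrite !inE ?r //; apply: contra nxy => lyx; apply/eqP/a.
by rewrite lxy.
Qed.

Lemma srank_bounds s : (least_rank (size s) <= srank s < least_rank (size s).+1)%N.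
Proof.
elim: s => [|x s /andP[lo hi]]; first by rewrite least_rankS /least_rank big_ord0.
have d1 := digit_gt0 x; have dK : (digit x <= #|{: gen m}|)%N by apply: max_card.
move: hi; rewrite [size (_ :: _)]/= !least_rankS expnS => hi.
have := leq_mul d1 (leqnn (#|{: gen m}| ^ size s)).
have := leq_mul dK (leqnn (#|{: gen m}| ^ size s)).
by rewrite -[srank (_ :: _)]/(_ + srank s)%N => h1 h2; apply/andP; split; lia.
Qed.

Lemma lex_lt_srank s t : size s = size t -> lex_lt le s t -> (srank s < srank t)%N.
Proof.
elim: s t => [|x s IH] [|y t] //= [st] /orP[/andP[nxy lxy]|/andP[/eqP-> l]].
  have dxy := digit_lt nxy lxy.
  have /andP[_ hi] := srank_bounds s; have /andP[lo _] := srank_bounds t.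
  move: hi lo; rewrite least_rankS st => hi lo.
  have : ((digit x).+1 * #|{: gen m}| ^ size t <= digit y * #|{: gen m}| ^ size t)%N.
    by rewrite leq_mul2r dxy orbT.
  by rewrite mulSn; lia.
by rewrite st ltn_add2l IH.
Qed.

Lemma least_rank_le n p : (n <= p)%N -> (least_rank n <= least_rank p)%N.
Proof.
move=> np; rewrite /least_rank -(subnKC np) big_split_ord /=; exact: leq_addr.
Qed.

Lemma word_lt_rank_sub u v : word_lt le u v -> (rank u < rank v)%N.
Proof.
case/orP => [suv|/andP[/eqP suv l]]; last exact: lex_lt_srank.
have /andP[_ hi] := srank_bounds u; have /andP[lo _] := srank_bounds v.
exact: leq_trans hi (leq_trans (least_rank_le suv) lo).
Qed.

Lemma lex_lt_total s t : size s = size t -> s != t -> lex_lt le s t || lex_lt le t s.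
Proof.
case: le_lin => _ _ _ tot.
elim: s t => [|x s IH] [|y t] //= [st]; rewrite eqseq_cons negb_and.
have [->|nxy] /= := eqVneq x y; first by rewrite ?eqxx /= => /IH->.
by rewrite !orbF tot.
Qed.

Lemma word_inj (u v : word m) : seq_of_word u = seq_of_word v -> u = v.
Proof. by case: u v => [s] [t] /= ->. Qed.

Lemma word_lt_total u v : u != v -> word_lt le u v || word_lt le v u.
Proof.
move=> nuv; rewrite /word_lt; case: (ltngtP (size u) (size v)) => //= suv.
exact: lex_lt_total.
Qed.

Lemma word_ltE u v : word_lt le u v = (rank u < rank v)%N.
Proof.
apply/idP/idP => [/word_lt_rank_sub//|uv].
have nuv : u != v by apply: contraTneq uv => ->; rewrite ltnn.
by case/orP: (word_lt_total nuv) => // /word_lt_rank_sub; lia.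
Qed.

Lemma rank_inj : injective rank.
Proof.
move=> u v uv; apply/eqP/negPn/negP => /word_lt_total.
by rewrite !word_ltE uv ltnn.
Qed.

Lemma word_supE u v : rank (word_sup le u v) = maxn (rank u) (rank v).
Proof. by rewrite /word_sup word_ltE; case: ltnP. Qed.

Lemma lex_lt_cat p s t q : size s = size t ->
  lex_lt le (p ++ s ++ q) (p ++ t ++ q) = lex_lt le s t.
Proof.
move=> st; elim: p => [|x p /= ->]; last by rewrite eqxx.
rewrite !cat0s; elim: s t st => [|x s IH] [|y t] //= => [_|[st]]; last by rewrite IH.
by elim: q => //= x q ->; rewrite eqxx.
Qed.

Lemma word_mulE (u v : word m) : seq_of_word (mmul u v) = seq_of_word u ++ seq_of_word v.
Proof. exact: fmM. Qed.

(** The order is compatible with the product of words on both sides. *)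
Lemma rank_mul a b u v :
  (rank (a * (u * b))%M < rank (a * (v * b))%M)%N = (rank u < rank v)%N.
Proof.
rewrite -!word_ltE /word_lt !word_mulE !size_cat ltn_add2l ltn_add2r.
rewrite eqn_add2l eqn_add2r; case: eqVneq => //= suv.
by rewrite lex_lt_cat.
Qed.

Lemma rank1 : rank 1%M = 0%N.
Proof. by rewrite /rank /seq_of_word fm1. Qed.

End Rank.

(** * Coefficients and leading words in the free algebra *)

Section FreeAlgebra.
Variables (C : numClosedFieldType) (m : nat).
Local Notation F := (free_star C m).
Implicit Types (f g h : F) (u v w x : word m) (c : C).

Lemma fcoefD f g w : (f + g)@_w = f@_w + g@_w.
Proof. exact: mcoeffD. Qed.

Lemma fcoefZ c f w : (c *: f)@_w = c * f@_w.
Proof. exact: mcoeffZ. Qed.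

Lemma fcoef0 w : (0 : F)@_w = 0.
Proof. exact: mcoeff0. Qed.

Lemma fcoefB f g w : (f - g)@_w = f@_w - g@_w.
Proof. exact: mcoeffB. Qed.

Lemma fcoef_sum (I : Type) (r : seq I) (P : pred I) (G : I -> F) w :
  (\sum_(i <- r | P i) G i)@_w = \sum_(i <- r | P i) (G i)@_w.
Proof. by apply: (big_morph (mcoeff w)) => [f g|]; rewrite ?fcoefD ?fcoef0. Qed.

Lemma fcoefP f g : (forall w, f@_w = g@_w) -> f = g.
Proof. by move=> fg; apply/malgP. Qed.

Lemma mem_msupp f w : (w \in msupp f) = (f@_w != 0).
Proof. by rewrite -mcoeff_neq0. Qed.

Lemma fcoef_mon u w : (mon C u)@_w = (u == w)%:R.
Proof. exact: mcoeffU. Qed.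

Lemma mon_sum f : f = \sum_(w <- msupp f) f@_w *: mon C w.
Proof.
apply: fcoefP => w; rewrite fcoef_sum.
under eq_bigr do rewrite fcoefZ fcoef_mon mulr_natr.
have [wf|wf] := boolP (w \in msupp f).
  rewrite (bigD1_seq w) ?fset_uniq //= eqxx mulr1n big1 ?addr0 // => v.
  by move=> /negPf->.
rewrite big1_seq => [|v /andP[_ vf]]; first exact: mcoeff_outdom.
by case: eqVneq => // vw; rewrite vw in vf; rewrite vf in wf.
Qed.

Lemma monM u v : mon C u * mon C v = mon C (u * v)%M.
Proof. by rewrite /mon; etransitivity; [exact: malgMUU | rewrite mulr1]. Qed.

Lemma mon1 : mon C (1%M : word m) = 1.
Proof. by []. Qed.

Lemma star_mon w : star (mon C w) = mon C (word_star w).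
Proof. by etransitivity; [exact: fstarU | rewrite rmorph1]. Qed.

Lemma fscaleAl c f g : c *: (f * g) = (c *: f) * g.
Proof. exact: free_scalerAl. Qed.

Lemma fscaleAr c f g : c *: (f * g) = f * (c *: g).
Proof. exact: free_scalerAr. Qed.

(** The terms of a f b, for words a and b, are the terms of f with a and b
    attached to their words. *)
Lemma sandwich_sum a h b : mon C a * h * mon C b =
  \sum_(x <- msupp h) h@_x *: mon C (a * (x * b))%M.
Proof.
rewrite {1}(mon_sum h) mulr_sumr mulr_suml; apply: eq_bigr => x _.
by rewrite -fscaleAr -fscaleAl !monM mulmA.
Qed.

Lemma word_mulI a x y : (a * x)%M = (a * y)%M -> x = y.
Proof.
move/(congr1 (@seq_of_word m)); rewrite !word_mulE => /eqP.
by rewrite eqseq_cat // eqxx /= => /eqP/word_inj.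
Qed.

Lemma word_mulIr a x y : (x * a)%M = (y * a)%M -> x = y.
Proof.
move/(congr1 (rev \o @seq_of_word m)); rewrite /= !word_mulE !rev_cat => /eqP.
rewrite eqseq_cat // eqxx /= => /eqP/(congr1 rev); rewrite !revK; exact: word_inj.
Qed.

Lemma fcoef_sandwich a h b x : (mon C a * h * mon C b)@_(a * (x * b))%M = h@_x.
Proof.
rewrite sandwich_sum [in RHS](mon_sum h) !fcoef_sum; apply: eq_bigr => y _.
rewrite !fcoefZ !fcoef_mon; congr (_ * (nat_of_bool _)%:R).
by apply/eqP/eqP => [/word_mulI/word_mulIr//|->].
Qed.

Lemma fcoef_sandwich_neq0 a h b w : (mon C a * h * mon C b)@_w != 0 ->
  exists2 x, h@_x != 0 & w = (a * (x * b))%M.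
Proof.
rewrite sandwich_sum fcoef_sum => nz; apply: contrapT => nex.
case/eqP: nz; rewrite big1_seq // => x /andP[_ xh].
rewrite fcoefZ fcoef_mon; case: eqVneq => [e|]; last by rewrite mulr0.
by case: nex; exists x; rewrite -?mem_msupp.
Qed.

End FreeAlgebra.

Section Lead.
Variables (C : numClosedFieldType) (m : nat) (le : rel (gen m)).
Hypothesis le_lin : linear_order le.
Local Notation F := (free_star C m).
Local Notation rank := (rank le).
Local Notation lead := (lead le).
Implicit Types (f g h : F) (u v w x : word m) (c : C).

(** The next three lemmas characterize lead f, for f <> 0, as the greatest word
    occurring in f. *)
Lemma lead_ge f w : f@_w != 0 -> (rank w <= rank (lead f))%N.
Proof.
rewrite -mem_msupp /lead.
have -> : (w \in msupp f) = (w \in enum_fset (msupp f)) by [].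
elim: (enum_fset (msupp f)) => // x s IH.
rewrite big_cons word_supE // inE => /orP[/eqP->|/IH]; first exact: leq_maxl.
by move/leq_trans; apply; apply: leq_maxr.
Qed.

Lemma lead_neq0 f : f != 0 -> f@_(lead f) != 0.
Proof.
move=> f0; rewrite -mem_msupp.
have : enum_fset (msupp f) != [::].
  apply: contra f0 => /eqP s0; apply/eqP/fcoefP => w; rewrite fcoef0.
  apply: mcoeff_outdom.
  by have -> : (w \in msupp f) = (w \in enum_fset (msupp f)) by []; rewrite s0.
rewrite /lead.
have -> : forall y, (y \in msupp f) = (y \in enum_fset (msupp f)) by [].
elim: (enum_fset (msupp f)) => // x s IH _; rewrite big_cons.
have [->|/IH ls] := eqVneq s [::].
  by rewrite big_nil /word_sup word_ltE // rank1 ltn0 mem_head.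
by rewrite /word_sup; case: ifP => _; rewrite inE ?ls ?eqxx ?orbT.
Qed.

Lemma lead_uniq f w : f@_w != 0 ->
  (forall x, f@_x != 0 -> (rank x <= rank w)%N) -> lead f = w.
Proof.
move=> fw mx; have f0 : f != 0 by apply: contraNneq fw => ->; rewrite fcoef0.
by apply: (rank_inj le_lin); apply/eqP; rewrite eqn_leq lead_ge // mx // lead_neq0.
Qed.

Lemma lead_sandwich a h b : h != 0 ->
  lead (mon C a * h * mon C b) = (a * (lead h * b))%M.
Proof.
move=> h0; apply: lead_uniq => [|x].
  by rewrite fcoef_sandwich lead_neq0.
case/fcoef_sandwich_neq0 => y hy ->; rewrite leqNgt rank_mul // -leqNgt.
exact: lead_ge.
Qed.

End Lead.

(** * The composition lemma *)

Lemma mul_sandwich (R : pzRingType) (a b c d s : R) :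
  a * (b * s * c) * d = (a * b) * s * (c * d).
Proof. by rewrite !mulrA. Qed.

(** In c p + h, replaces p by a multiple of q modulo k p - l q; see
    [multiples_top]. *)
Lemma scale_exchange (K : fieldType) (V : lmodType K) (p q h : V) (c c' k l : K) :
  k != 0 -> c / k *: (k *: p - l *: q) + (h - c' *: q) =
            c *: p + h - (c / k * l + c') *: q.
Proof.
move=> k0; rewrite scalerBr !scalerA divfK // scalerDl opprD.
by rewrite addrACA.
Qed.

Section SPolyIdentities.
Variables (C : numClosedFieldType) (A : starAlgType C).
Implicit Types (c : C) (x y s l e d : A).

(** Disjoint leading words l and l': both tails s - c l and s' - c' l' come into
    play.  These identities are stated for abstract elements so that rewriting
    does not unfold the products of the free algebra. *)
Lemma spoly_disjointE x y s s' l e l' c c' :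
  cscale c' (x * s * (e * (l' * y))) - cscale c (x * (l * e) * s' * y) =
  x * ((s - cscale c l) * e * s' - s * e * (s' - cscale c' l')) * y.
Proof.
have -> : (s - cscale c l) * e * s' - s * e * (s' - cscale c' l') =
    cscale c' (s * e * l') - cscale c (l * e * s').
  rewrite !mulrBl mulrBr -!cscaleAl -cscaleAr opprB.
  by rewrite addrC addrA subrK.
by rewrite mulrBr mulrBl -!cscaleAr -!cscaleAl !mulrA.
Qed.

(** Overlapping leading words: the difference is a multiple of the result of a
    composition. *)
Lemma spoly_overlapE x y s s' d e c c' :
  cscale c' (x * s * (d * y)) - cscale c (x * e * s' * y) =
  x * (cscale c' (s * d) - cscale c (e * s')) * y.
Proof. by rewrite mulrBr mulrBl -!cscaleAr -!cscaleAl !mulrA. Qed.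

End SPolyIdentities.

Section Diamond.
Variables (C : numClosedFieldType) (m : nat) (le : rel (gen m)).
Hypothesis le_lin : linear_order le.
Local Notation F := (free_star C m).
Local Notation rank := (rank le).
Local Notation lead := (lead le).
Implicit Types (f g h : F) (u v w x a b : word m) (c : C).

Variable S : set F.

(** The linear span of the products a s b, with s in S and words a and b, whose
    leading word a (lead s) b satisfies P. *)
Inductive multiples (P : word m -> Prop) : F -> Prop :=
| multiples0 : multiples P 0
| multiplesDZ c a s b g : S s -> P (a * (lead s * b))%M -> multiples P g ->
    multiples P (c *: (mon C a * s * mon C b) + g).

Local Notation below w := (fun x => (rank x < rank w)%N).

Section Span.
Variable P : word m -> Prop.

Lemma multiplesD f g : multiples P f -> multiples P g -> multiples P (f + g).
Proof.
elim=> [|c a s b h Ss Pw _ IH] Pg; first by rewrite add0r.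
by rewrite -addrA; apply: multiplesDZ => //; apply: IH.
Qed.

Lemma multiplesZ c f : multiples P f -> multiples P (c *: f).
Proof.
elim=> [|d a s b h Ss Pw _ IH]; first by rewrite scaler0; left.
by rewrite scalerDr scalerA; apply: multiplesDZ.
Qed.

Lemma multiplesB f g : multiples P f -> multiples P g -> multiples P (f - g).
Proof. by move=> Pf Pg; rewrite -scaleN1r; apply/multiplesD/multiplesZ. Qed.

Lemma multiples_sum (I : eqType) (r : seq I) (G : I -> F) :
  (forall i, i \in r -> multiples P (G i)) -> multiples P (\sum_(i <- r) G i).
Proof.
move=> PG; rewrite big_seq; apply: (big_ind (multiples P)) => //; first by left.
exact: multiplesD.
Qed.

Lemma multiples_sandwich a s b : S s -> P (a * (lead s * b))%M ->
  multiples P (mon C a * s * mon C b).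
Proof.
by move=> Ss Pw; rewrite -[_ * _]addr0 -[_ * _]scale1r; apply: multiplesDZ => //; left.
Qed.

Lemma multiples_mulr f e s : S s ->
  (forall x, f@_x != 0 -> P (x * (e * lead s))%M) ->
  multiples P (f * mon C e * s).
Proof.
move=> Ss Pf; rewrite -mulrA {1}(mon_sum f) mulr_suml; apply: multiples_sum => x.
rewrite mem_msupp => fx; rewrite -fscaleAl mulrA monM -[_ * s]mulr1 -(mon1 C m).
by apply/multiplesZ/multiples_sandwich; rewrite // mulm1 -mulmA; apply: Pf.
Qed.

Lemma multiples_mull f e s : S s ->
  (forall x, f@_x != 0 -> P (lead s * (e * x))%M) ->
  multiples P (s * mon C e * f).
Proof.
move=> Ss Pf; rewrite {1}(mon_sum f) mulr_sumr; apply: multiples_sum => x.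
rewrite mem_msupp => fx; rewrite -fscaleAr -mulrA monM -[s]mul1r -(mon1 C m).
by apply/multiplesZ/multiples_sandwich; rewrite // mul1m; apply: Pf.
Qed.

End Span.

Lemma multiplesS (P Q : word m -> Prop) f :
  (forall w, P w -> Q w) -> multiples P f -> multiples Q f.
Proof.
move=> PQ; elim=> [|c a s b h Ss Pw _ IH]; first by left.
by right => //; apply: PQ.
Qed.

Lemma mon_sandwich a a' s b' b :
  mon C a * (mon C a' * s * mon C b') * mon C b =
  mon C (a * a')%M * s * mon C (b' * b)%M.
Proof.
rewrite -(monM C a a') -(monM C b' b).
exact: (@mul_sandwich F).
Qed.

Lemma multiplesM (P Q : word m -> Prop) a b f :
    (forall w, P w -> Q (a * (w * b))%M) -> multiples P f ->
  multiples Q (mon C a * f * mon C b).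
Proof.
move=> PQ; elim=> [|c a' s b' h Ss Pw _ IH]; first by rewrite mulr0 mul0r; left.
rewrite mulrDr mulrDl -fscaleAr -fscaleAl.
rewrite [X in c *: X](mon_sandwich a a' s b' b).
by right => //; move: (PQ _ Pw); rewrite !mulmA.
Qed.

Lemma word_split u v u' v' : (u * v)%M = (u' * v')%M -> (size u <= size u')%N ->
  exists2 e, u' = (u * e)%M & v = (e * v')%M.
Proof.
move/(congr1 (@seq_of_word m)); rewrite !word_mulE => uv su.
exists (FMonom (drop (size u) u')); apply: word_inj; rewrite word_mulE.
  have -> : seq_of_word u = take (size u) u'.
    by move/(congr1 (take (size u))): uv; rewrite take_size_cat // takel_cat.
  by rewrite size_takel // cat_take_drop.
have := congr1 (drop (size u)) uv; rewrite drop_size_cat // => ->.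
rewrite drop_cat; case: ltnP => // us; rewrite (_ : size u = size u').
  by rewrite drop_size subnn drop0.
by apply/eqP; rewrite eqn_leq su us.
Qed.

Hypothesis clS : closed_under_compositions le S.

Lemma elt_neq0 s : S s -> s != 0.
Proof. by case: clS => S0 _ _ Ss; apply: contraPneq S0 => e; case; rewrite -e. Qed.

Lemma lead_infix_eq s t : S s -> S t -> infix (lead s) (lead t) -> s = t.
Proof.
case: clS => _ irr _ Ss St; apply: contraTeq; exact: irr.
Qed.

Lemma infix_mul a w b : infix w (seq_of_word (a * (w * b))%M).
Proof. by apply/infixP; exists a, b; rewrite !word_mulE. Qed.

Lemma reducible_belowW w f : reducible_below le S w f -> multiples (below w) f.
Proof.
case=> r -> rS; apply: multiples_sum => -[[[c a] s] b] /rS[Ss].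
rewrite lead_sandwich ?elt_neq0 // word_ltE // => lw.
exact/multiplesZ/multiples_sandwich.
Qed.

Lemma tail_lt s x : S s ->
  (s - s@_(lead s) *: mon C (lead s))@_x != 0 -> (rank x < rank (lead s))%N.
Proof.
move=> Ss; rewrite fcoefB fcoefZ fcoef_mon; have [<-|nx] := eqVneq (lead s) x.
  by rewrite mulr1 subrr eqxx.
rewrite mulr0 subr0 => /(lead_ge le_lin); rewrite leq_eqVlt => /orP[/eqP/(rank_inj le_lin) xs|//].
by rewrite xs eqxx in nx.
Qed.

(** The combination of a s b and a' s' b' in which the terms in their leading
    words cancel when these words are equal. *)
Definition spoly a s b a' s' b' : F :=
  s'@_(lead s') *: (mon C a * s * mon C b) - s@_(lead s) *: (mon C a' * s' * mon C b').

Lemma spolyN a s b a' s' b' : spoly a s b a' s' b' = - spoly a' s' b' a s b.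
Proof. by rewrite opprB. Qed.

Lemma spoly_disjoint a s e s' b : S s -> S s' ->
  multiples (below (a * (lead s * (e * (lead s' * b))))%M)
    (spoly a s (e * (lead s' * b))%M (a * (lead s * e))%M s' b).
Proof.
move=> Ss Ss'.
rewrite (_ : spoly _ _ _ _ _ _ =
    mon C a * ((s - s@_(lead s) *: mon C (lead s)) * mon C e * s' -
      s * mon C e * (s' - s'@_(lead s') *: mon C (lead s'))) * mon C b); last first.
  have e1 : mon C (e * (lead s' * b))%M = mon C e * (mon C (lead s') * mon C b).
    by rewrite (monM C (lead s') b) (monM C e).
  have e2 : mon C (a * (lead s * e))%M = mon C a * (mon C (lead s) * mon C e).
    by rewrite (monM C (lead s) e) (monM C a).
  pose G (p q : F) := s'@_(lead s') *: (mon C a * s * p) - s@_(lead s) *: (q * s' * mon C b).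
  by apply: etrans (f_equal2 G e1 e2) _; exact: (@spoly_disjointE C F).
apply: (@multiplesM (below (lead s * (e * lead s'))%M)) => [w|].
  have -> : (a * (lead s * (e * (lead s' * b))) = a * ((lead s * (e * lead s')) * b))%M.
    by rewrite !mulmA.
  by rewrite rank_mul.
apply: multiplesB; [apply: multiples_mulr|apply: multiples_mull] => // x /tail_lt lt.
  have := rank_mul le_lin 1%M (e * lead s')%M x (lead s); rewrite !mul1m => ->.
  exact: lt.
have := rank_mul le_lin (lead s * e)%M 1%M x (lead s'); rewrite !mulm1 !mulmA => ->.
exact: lt.
Qed.

Lemma word_eq1 w : size w = 0%N -> w = 1%M.
Proof. by move/size0nil => e; apply: word_inj; rewrite e /seq_of_word fm1. Qed.

(** The leading words of s and s' occur in the same word, that of s not to the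
    right of that of s'.  Either they are disjoint, or one contains the other and
    then s = s', or they overlap and s and s' form a composition. *)
Lemma spoly_below_le a s b a' s' b' : S s -> S s' -> (size a <= size a')%N ->
  (a * (lead s * b))%M = (a' * (lead s' * b'))%M ->
  multiples (below (a * (lead s * b))%M) (spoly a s b a' s' b').
Proof.
move=> Ss Ss' aa' eqw; have [e ea' elb] := word_split eqw aa'; subst a'.
(* e is the part of the word between the beginnings of the two leading words *)
have [le_e|lt_e] := leqP (size (lead s)) (size e).
  have [e' -> ->] := word_split elb le_e; exact: spoly_disjoint.
rewrite mulmA in elb.
have [le_l|lt_l] := leqP (size (seq_of_word (e * lead s')%M)) (size (lead s)).
  have [d ls eb'] := word_split (esym elb) le_l.
  have ss' : s' = s.
    by apply: lead_infix_eq => //; rewrite ls -mulmA infix_mul.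
  subst s'; have := congr1 (fun w => size (seq_of_word w)) ls.
  rewrite !word_mulE !size_cat => sz.
  have e1 : e = 1%M by apply: word_eq1; lia.
  have d1 : d = 1%M by apply: word_eq1; lia.
  rewrite eb' e1 d1 mul1m mulm1 /spoly subrr; left.
have [d eld eb] := word_split elb (ltnW lt_l).
have sd : size d != 0%N.
  by move: lt_l; rewrite eld word_mulE size_cat -[X in (X < _)%N]addn0 ltn_add2l lt0n.
have se : size e != 0%N.
  apply/eqP => /word_eq1 e1; rewrite e1 mul1m in eld.
  have ss' : s = s'.
    by apply: lead_infix_eq => //; have := infix_mul 1%M (lead s) d; rewrite mul1m -eld.
  have := congr1 (fun w => size (seq_of_word w)) eld.
  by rewrite word_mulE size_cat ss' => /eqP;
    rewrite -[X in X == _]addn0 eqn_add2l eq_sym (negPf sd).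
have sz_neq1 w : size w != 0%N -> w != 1%M.
  by apply: contraNneq => ->; rewrite /seq_of_word fm1.
have fc : forms_composition le s s' (lead s * d)%M d e.
  by split => //; apply: sz_neq1.
case: clS => _ _ /(_ _ _ _ _ _ Ss Ss' fc) /reducible_belowW.
move=> /(@multiplesM _ (below (a * (lead s * b))%M) a b') H.
rewrite (_ : spoly _ _ _ _ _ _ =
  mon C a * composition_result le s s' d e * mon C b').
  apply: H => w; have -> : (a * (lead s * b) = a * ((lead s * d) * b'))%M.
    by rewrite eb -!mulmA.
  by rewrite rank_mul.
have e1 : mon C b = mon C d * mon C b' by rewrite eb (monM C d).
pose G (p q : F) := s'@_(lead s') *: (mon C a * s * p) - s@_(lead s) *: (q * s' * mon C b').
apply: etrans (f_equal2 G e1 (esym (monM C a e))) _; exact: (@spoly_overlapE C F).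
Qed.

(** The diamond lemma proper: two multiples of elements of S with the same
    leading word w differ, once the coefficients
    of w are made equal, by a combination of multiples
    with leading words less than w. *)
Lemma spoly_below a s b a' s' b' : S s -> S s' ->
  (a * (lead s * b))%M = (a' * (lead s' * b'))%M ->
  multiples (below (a * (lead s * b))%M) (spoly a s b a' s' b').
Proof.
move=> Ss Ss' eqw; case: (leqP (size a) (size a')) => [aa'|/ltnW aa'].
  exact: spoly_below_le.
rewrite spolyN -scaleN1r eqw; apply: multiplesZ; exact: spoly_below_le.
Qed.

Lemma multiples_coef_lt n f x : multiples (fun w => (rank w < n)%N) f ->
  f@_x != 0 -> (rank x < n)%N.
Proof.
elim=> [|c a s b h Ss lt _ IH]; first by rewrite fcoef0 eqxx.
rewrite fcoefD; have [->|hx _] := eqVneq h@_x 0; last exact: IH.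
rewrite addr0 fcoefZ mulf_eq0 negb_or => /andP[_ /(lead_ge le_lin)].
by rewrite lead_sandwich ?elt_neq0 // => /leq_ltn_trans; apply.
Qed.

(** Modulo multiples of rank less than n, all the multiples of rank n are
    proportional to each other, so that at most one of them is needed. *)
Lemma multiples_top n f : multiples (fun w => (rank w < n.+1)%N) f ->
  multiples (fun w => (rank w < n)%N) f \/
  exists c a s b, [/\ S s, c != 0, rank (a * (lead s * b))%M = n &
    multiples (fun w => (rank w < n)%N) (f - c *: (mon C a * s * mon C b))].
Proof.
elim=> [|c a s b h Ss le_n _ IH]; first by left; left.
have [->|c0] := eqVneq c 0; first by rewrite scale0r add0r.
move: le_n; rewrite ltnS leq_eqVlt => /orP[/eqP rw|lt_n]; last first.
  case: IH => [Vh|[c' [a' [s' [b' [Ss' c'0 rw Vh]]]]]]; first by left; right.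
  right; exists c', a', s', b'; split=> //.
  by rewrite -addrA; right.
case: IH => [Vh|[c' [a' [s' [b' [Ss' c'0 rw' Vh]]]]]].
  by right; exists c, a, s, b; split=> //; rewrite addrC addKr.
have eqw : (a * (lead s * b))%M = (a' * (lead s' * b'))%M.
  by apply: (rank_inj le_lin); rewrite rw.
have Vs := spoly_below Ss Ss' eqw; rewrite rw in Vs.
have al'0 := lead_neq0 le_lin (elt_neq0 Ss').
pose d := c / s'@_(lead s') * s@_(lead s) + c'.
have Vd : multiples (fun w => (rank w < n)%N)
    (c *: (mon C a * s * mon C b) + h - d *: (mon C a' * s' * mon C b')).
  have := multiplesD (multiplesZ (c / s'@_(lead s')) Vs) Vh.
  by rewrite [X in multiples _ X](@scale_exchange C F _ _ _ _ _ _ _ al'0).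
have [d0|dn0] := eqVneq d 0; first by left; rewrite d0 scale0r subr0 in Vd.
by right; exists d, a', s', b'; split.
Qed.

(** By descent on n: either the single multiple of rank n provided by
    [multiples_top] contributes the leading word, or f is a combination of
    multiples of lower rank. *)
Lemma multiples_lead n f : multiples (fun w => (rank w < n)%N) f -> f != 0 ->
  exists2 s, S s & infix (lead s) (lead f).
Proof.
elim: n f => [|n IH] f Vf f0.
  by have := multiples_coef_lt Vf (lead_neq0 le_lin f0).
have [/IH/(_ f0)//|[c [a [s [b [Ss c0 rw Vg]]]]]] := multiples_top Vf.
exists s => //; rewrite (_ : lead f = (a * (lead s * b))%M) ?infix_mul //.
apply: lead_uniq => // [|x fx]; last first.
  by rewrite rw -ltnS; apply: multiples_coef_lt Vf fx.
rewrite -[f](subrK (c *: (mon C a * s * mon C b))) fcoefD.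
set g := f - _ in Vg *; have [->|gx] := eqVneq g@_(a * (lead s * b))%M 0; last first.
  by have := multiples_coef_lt Vg gx; rewrite rw ltnn.
by rewrite add0r fcoefZ fcoef_sandwich mulf_neq0 // lead_neq0 // elt_neq0.
Qed.

Lemma multiples_bounded P f : multiples P f ->
  exists n, multiples (fun w => (rank w < n)%N) f.
Proof.
elim=> [|c a s b h Ss _ _ [n Vh]]; first by exists 0%N; left.
exists (maxn n (rank (a * (lead s * b))%M).+1); right => //.
  by rewrite leq_max ltnSn orbT.
by apply: multiplesS Vh => w /leq_trans; apply; apply: leq_maxl.
Qed.

Lemma ideal_multiples f : ideal_gen S f -> multiples (fun=> True) f.
Proof.
pose V : set F := multiples (fun=> True).
have VM u v g : V g -> V (mon C u * g * mon C v).
  by apply: multiplesM.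
apply; last first.
  move=> s Ss; rewrite -[s]mul1r -[X in multiples _ X]mulr1 -(mon1 C m).
  exact: multiples_sandwich.
split=> [|g h|g h Vh|g h Vg]; first by left.
- exact: multiplesB.
- rewrite {1}(mon_sum g) mulr_suml; apply: multiples_sum => x _.
  rewrite -fscaleAl; apply: multiplesZ.
  by rewrite -[X in multiples _ X]mulr1 -(mon1 C m); apply: VM.
- rewrite {1}(mon_sum h) mulr_sumr; apply: multiples_sum => x _.
  rewrite -fscaleAr; apply: multiplesZ.
  by rewrite -[g]mul1r -(mon1 C m); apply: VM.
Qed.

(** Uniqueness of normal forms. *)
Lemma spanBW_ideal0 f : spanBW le S f -> ideal_gen S f -> f = 0.
Proof.
move=> Bf /ideal_multiples/multiples_bounded[n Vf]; apply/eqP; apply: contraT => f0.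
have [s Ss] := multiples_lead Vf f0.
by rewrite (negPf (Bf _ (lead_neq0 le_lin f0) _ Ss)).
Qed.

End Diamond.

(** * Normal forms *)

Section IdealTheory.
Variables (C : numClosedFieldType) (A : starAlgType C) (S : set A).
Local Notation I := (ideal_gen S).

Let tI := ideal_gen_tsi S.

Lemma ideal_genN a : I a -> I (- a).
Proof. by move=> Ia; rewrite -sub0r; apply: (tsiB tI) (tsi0 tI) Ia. Qed.

Lemma ideal_genD a b : I a -> I b -> I (a + b).
Proof. by move=> Ia Ib; rewrite -[b]opprK; apply: (tsiB tI) Ia (ideal_genN Ib). Qed.

Lemma ideal_genZ c a : I a -> I (cscale c a).
Proof. by move=> Ia; rewrite -[a]mul1r cscaleAl; apply: (tsiMl tI). Qed.

Lemma ideal_gen_mem a : S a -> I a.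
Proof. by move=> Sa J _; apply. Qed.

End IdealTheory.

Section NormalForm.
Variables (C : numClosedFieldType) (m : nat) (le : rel (gen m)).
Hypothesis le_lin : linear_order le.
Local Notation F := (free_star C m).
Local Notation rank := (rank le).
Local Notation lead := (lead le).
Implicit Types (f g h : F) (u v w x a b : word m) (c : C).

Variable S : set F.
Hypothesis clS : closed_under_compositions le S.
Local Notation I := (ideal_gen S).
Local Notation RS := (RS le S).

Lemma spanBW0 : spanBW le S 0.
Proof. by move=> w; rewrite fcoef0 eqxx. Qed.

Lemma spanBWD f g : spanBW le S f -> spanBW le S g -> spanBW le S (f + g).
Proof.
move=> Bf Bg w; rewrite fcoefD; have [->|/Bf//] := eqVneq f@_w 0.
by rewrite add0r; apply: Bg.
Qed.

Lemma spanBWZ c f : spanBW le S f -> spanBW le S (c *: f).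
Proof. by move=> Bf w; rewrite fcoefZ mulf_eq0 negb_or => /andP[_]; apply: Bf. Qed.

Lemma spanBWB f g : spanBW le S f -> spanBW le S g -> spanBW le S (f - g).
Proof. by move=> Bf Bg; rewrite -scaleN1r; apply/spanBWD/spanBWZ. Qed.

Lemma spanBW_mon w : BW le S w -> spanBW le S (mon C w).
Proof. by move=> Bw x; rewrite fcoef_mon; have [<-|_] := eqVneq w x; rewrite ?eqxx. Qed.

(** f is congruent modulo the ideal to a combination of words of BW. *)
Definition has_nf f := exists2 r, spanBW le S r & I (f - r).

Lemma has_nfD f g : has_nf f -> has_nf g -> has_nf (f + g).
Proof.
move=> [r Br Ir] [r' Br' Ir']; exists (r + r'); first exact: spanBWD.
by rewrite opprD addrACA; apply: ideal_genD.
Qed.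

Lemma has_nfZ c f : has_nf f -> has_nf (c *: f).
Proof.
move=> [r Br Ir]; exists (c *: r); first exact: spanBWZ.
by rewrite -scalerBr; apply: (ideal_genZ c Ir).
Qed.

Lemma has_nf_sum f : (forall x, f@_x != 0 -> has_nf (mon C x)) -> has_nf f.
Proof.
move=> nf; rewrite (mon_sum f) big_seq; apply: (big_ind has_nf).
- by exists 0; [exact: spanBW0 | rewrite subrr; apply: tsi0 (ideal_gen_tsi S)].
- exact: has_nfD.
- by move=> x; rewrite mem_msupp => /nf; apply: has_nfZ.
Qed.

Lemma has_nf_ideal f g : I (f - g) -> has_nf g -> has_nf f.
Proof.
move=> Ifg [r Br Ir]; exists r => //.
by rewrite -[f](subrK g) -addrA; apply: ideal_genD.
Qed.

(** Existence of normal forms, by induction on the rank: a word outside BW is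
    rewritten into smaller words by an element of S. *)
Lemma has_nf_mon w : has_nf (mon C w).
Proof.
have [n] := ubnP (rank w); elim: n w => // n IH w; rewrite ltnS => wn.
have [Bw|/existsNP[s /not_implyP[Ss /negP/negPn/infixP[a [b wE]]]]] := pselect (BW le S w).
  exists (mon C w); first exact: spanBW_mon.
  by rewrite subrr; apply: tsi0 (ideal_gen_tsi S).
have {}wE : w = (FMonom a * (lead s * FMonom b))%M by apply: word_inj; rewrite !word_mulE.
have al0 := lead_neq0 le_lin (elt_neq0 clS Ss).
pose p : F := mon C (FMonom a) * s * mon C (FMonom b).
have lp : lead p = w by rewrite lead_sandwich ?(elt_neq0 clS) -?wE.
have pw : p@_w = s@_(lead s) by rewrite wE fcoef_sandwich.
apply: (@has_nf_ideal _ (mon C w - (s@_(lead s))^-1 *: p)).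
  rewrite subKr; apply: (ideal_genZ (A := F)).
  apply: (tsiMr (ideal_gen_tsi S)); apply: (tsiMl (ideal_gen_tsi S)).
  exact: ideal_gen_mem.
apply: has_nf_sum => x; rewrite fcoefB fcoefZ fcoef_mon => nz; apply: IH.
apply: leq_trans wn; move: nz; have [<-|nwx] := eqVneq w x.
  by rewrite pw mulVf // subrr eqxx.
rewrite sub0r oppr_eq0 mulf_eq0 negb_or => /andP[_ /(lead_ge le_lin)].
rewrite lp leq_eqVlt => /orP[/eqP/(rank_inj le_lin) xw|//].
by rewrite xw eqxx in nwx.
Qed.

Lemma RSP f : spanBW le S (RS f) /\ I (f - RS f).
Proof.
have [r Br Ir] : has_nf f by apply: has_nf_sum => x _; apply: has_nf_mon.
by rewrite /RS; case: xgetP => [_ -> //|/(_ r)[]].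
Qed.

Lemma RS_uniq f r : spanBW le S r -> I (f - r) -> RS f = r.
Proof.
move=> Br Ir; have [Bf If] := RSP f; apply/eqP; rewrite -subr_eq0; apply/eqP.
apply: (spanBW_ideal0 le_lin clS); first exact: spanBWB.
rewrite (_ : RS f - r = (f - r) - (f - RS f)).
  exact: (tsiB (ideal_gen_tsi S)).
by rewrite opprB [RHS]addrC addrA subrK.
Qed.

Lemma RSD f g : RS (f + g) = RS f + RS g.
Proof.
have [Bf If] := RSP f; have [Bg Ig] := RSP g.
apply: RS_uniq; first exact: spanBWD.
by rewrite opprD addrACA; apply: ideal_genD.
Qed.

Lemma RSZ c f : RS (c *: f) = c *: RS f.
Proof.
have [Bf If] := RSP f; apply: RS_uniq; first exact: spanBWZ.
by rewrite -scalerBr; apply: (ideal_genZ c If).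
Qed.

Lemma RS_id f : spanBW le S f -> RS f = f.
Proof. by move=> Bf; apply: RS_uniq; rewrite // subrr; apply: tsi0 (ideal_gen_tsi S). Qed.

Lemma RS_ideal f : I f -> RS f = 0.
Proof. by move=> If; apply: RS_uniq; rewrite ?subr0 //; apply: spanBW0. Qed.

End NormalForm.

(** * The GNS construction *)

Section GNS.
Variables (C : numClosedFieldType).

(** A *-algebra seen as a module over C, on which it acts by left
    multiplication. *)
Definition gns_space (A : starAlgType C) : Type := A.
HB.instance Definition _ (A : starAlgType C) := GRing.Zmodule.on (gns_space A).
HB.instance Definition _ (A : starAlgType C) :=
  GRing.Zmodule_isLmodule.Build C (gns_space A)
    (@cscaleA C A) (@cscale1 C A) (@cscaleDr C A) (@cscaleDl C A).

Variables (A : starAlgType C) (T : A -> C).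
Hypothesis TD : forall a b, T (a + b) = T a + T b.
Hypothesis TZ : forall c a, T (cscale c a) = c * T a.
Hypothesis T_star : forall a, T (star a) = (T a)^*.
Hypothesis T_gt0 : forall a, a != 0 -> 0 < T (a * star a).

Local Notation E := (gns_space A).

(** The form <x, y> = T(y^* x), linear in x and antilinear in y. *)
Definition gns_form (x y : E) : C := T (star (y : A) * (x : A)).

Let TB a b : T (a - b) = T a - T b.
Proof. by have := TD (a - b) b; rewrite subrK => ->; rewrite addrK. Qed.

Lemma gns_form_dot : exists ip : {dot E for conjC}, forall x y, ip x y = gns_form x y.
Proof.
have f1 (y : E) : zmod_morphism (gns_form^~ y).
  by move=> x z; rewrite /gns_form mulrBr TB.
have f2 (x : E) : zmod_morphism (gns_form x).
  by move=> y z; rewrite /gns_form starB mulrBl TB.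
have f3 (y : E) : scalable_for *%R (gns_form^~ y).
  by move=> c x; rewrite /gns_form -cscaleAr TZ.
have f4 (x : E) : scalable_for (conjC \; *%R) (gns_form x).
  by move=> c y; rewrite /gns_form starZ -cscaleAl TZ.
have f5 (x y : E) : gns_form x y = (-1) ^+ false * (gns_form y x)^*.
  by rewrite expr0 mul1r /gns_form -T_star starM starK.
have f6 (x : E) : x != 0 -> 0 < gns_form x x.
  move=> x0; have := @T_gt0 (star (x : A)); rewrite starK; apply.
  by apply: contra_neq x0 => s0; rewrite -(starK (x : A)) s0 star0.
pose b := isBilinear.Build C E E C *%R (conjC \; *%R) gns_form f1 f2 f3 f4.
pose h := isHermitianSesquilinear.Build C E false conjC gns_form f5.
pose d := isDotProduct.Build C E gns_form f6.
pose ip : {dot E for conjC} := HB.pack gns_form b h d.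
by exists ip.
Qed.

Lemma gns_representation : exists (ip : {dot E for conjC}) (rho : A -> adjop ip),
  is_star_morphism rho /\ injective rho.
Proof.
have [ip ipE] := gns_form_dot.
pose L (a : A) (x : E) : E := a * (x : A).
have Llin a : linear (L a).
  move=> c x y; rewrite /L; etransitivity; first exact: (mulrDr a).
  congr (_ + _); exact: (esym (@cscaleAr C A c a x)).
have Ladj a : adjoint_of ip (L a) (L (star a)).
  by move=> x y; rewrite !ipE /gns_form /L starM starK mulrA.
pose rho a : adjop ip := Adjop (Llin a) (ex_intro2 _ _ _ (Llin (star a)) (Ladj a)).
exists ip, rho; split; first split.
- by move=> a b; apply: adjopP => x /=; apply: (mulrDl a b).
- by move=> c a; apply: adjopP => x /=; rewrite /L -cscaleAl.
- by move=> a b; apply: adjopP => x /=; rewrite /L mulrA.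
- by apply: adjopP => x /=; apply: mul1r.
- by move=> a; apply: adjopP => x; apply/esym/adj_fun_uniq/Ladj.
- move=> a b /(congr1 (fun S : adjop ip => S (1 : A))) /=.
  by rewrite /L !mulr1.
Qed.

End GNS.

(** * Recursion on the natural numbers and diagonal dominance *)

(** Course-of-values recursion: Phi n receives the values below n, extended by
    the default value x0. *)
Lemma strong_recursion (T : Type) (x0 : T) (Phi : nat -> (nat -> T) -> T) :
  exists alpha : nat -> T,
    forall n, alpha n = Phi n (fun k => if (k < n)%N then alpha k else x0).
Proof.
pose fix L n := if n is k.+1 then rcons (L k) (Phi k (nth x0 (L k))) else [::].
have sL n : size (L n) = n by elim: n => //= n IH; rewrite size_rcons IH.
have nthL n k : nth x0 (L n) k = if (k < n)%N then nth x0 (L k.+1) k else x0.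
  elim: n => [|n IH] /=; first by rewrite nth_nil.
  rewrite !nth_rcons !sL ltnn eqxx ltnS (leq_eqVlt k n).
  have [->|_] := eqVneq k n; first by rewrite ?ltnn.
  by rewrite /=; case: ifP => // kn; rewrite IH kn /= nth_rcons sL ltnn eqxx.
exists (fun n => nth x0 (L n.+1) n) => n; rewrite [LHS]/= nth_rcons sL ltnn eqxx.
by congr (Phi n _); apply: funext => k; rewrite nthL.
Qed.

Section Dominance.
Variable C : numClosedFieldType.

Lemma amgm (k k' h x y : C) : 0 <= k -> 0 <= k' -> 0 <= h -> 0 <= x -> 0 <= y ->
  h ^+ 2 <= k * k' -> x * y * h *+ 2 <= k * x ^+ 2 + k' * y ^+ 2.
Proof.
move=> k0 k'0 h0 x0 y0 hk.
have a0 : 0 <= x * y * h *+ 2 by apply: mulrn_wge0; rewrite !mulr_ge0.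
have kx0 : 0 <= k * x ^+ 2 by rewrite mulr_ge0 ?exprn_ge0.
have ky0 : 0 <= k' * y ^+ 2 by rewrite mulr_ge0 ?exprn_ge0.
rewrite -(@ler_pXn2r _ 2) ?nnegrE //; last exact: addr_ge0.
apply: (@le_trans _ _ ((k * x ^+ 2 * (k' * y ^+ 2)) *+ 4)).
  rewrite (_ : (x * y * h *+ 2) ^+ 2 = h ^+ 2 * (x * y) ^+ 2 *+ 4); last by ring.
  rewrite (_ : k * x ^+ 2 * (k' * y ^+ 2) = k * k' * (x * y) ^+ 2); last by ring.
  by rewrite lerMn2r /= ler_wpM2r // exprn_ge0 // mulr_ge0.
rewrite -subr_ge0 (_ : _ - _ = (k * x ^+ 2 - k' * y ^+ 2) ^+ 2); last by ring.
by rewrite real_exprn_even_ge0 // rpredB // ger0_real.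
Qed.

(** A hermitian form H is positive definite at the vectors z of support s if, for
    distinct u and v, |H u v| is at most the geometric mean of k u v and k v u, and each row
    sum of k is less than the diagonal entry of H.  The inequality
    2 |z u||z v||H u v| <= k u v |z u|^2 + k v u |z v|^2 bounds the off-diagonal
    part.  Hermitian symmetry is only used through the value being real. *)
Lemma diagonal_dominance (I : eqType) (s : seq I) (H k : I -> I -> C) (z : I -> C) :
    uniq s -> s != [::] -> (forall u, u \in s -> z u != 0) ->
    (forall u v, 0 <= k u v) ->
    {in s &, forall u v, u != v -> `|H u v| ^+ 2 <= k u v * k v u} ->
    {in s, forall u, \sum_(v <- s | v != u) k u v < H u u} ->
    \sum_(u <- s) \sum_(v <- s) z u * (z v)^* * H u v \is Num.real ->
  0 < \sum_(u <- s) \sum_(v <- s) z u * (z v)^* * H u v.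
Proof.
move=> us s0 z0 k0 Hk HD.
pose P := \sum_(u <- s) `|z u| ^+ 2 * H u u.
pose R := \sum_(u <- s) \sum_(v <- s | v != u) z u * (z v)^* * H u v.
have -> : \sum_(u <- s) \sum_(v <- s) z u * (z v)^* * H u v = P + R.
  rewrite -big_split /=; apply: eq_big_seq => u us'.
  by rewrite (bigD1_seq u) //= normCK.
have Hu0 u : u \in s -> 0 < H u u.
  by move=> us'; apply: le_lt_trans (HD _ us'); apply: sumr_ge0.
have Pr : P \is Num.real.
  rewrite /P big_seq; apply: rpred_sum => u us'.
  by rewrite rpredM ?rpredX ?normr_real // ger0_real // ltW // Hu0.
move=> PRr; have Rr : R \is Num.real.
  by have := rpredB PRr Pr; rewrite addrAC subrr add0r.
pose M := \sum_(u <- s) `|z u| ^+ 2 * \sum_(v <- s | v != u) k u v.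
have RM : `|R| <= M.
  rewrite -(@ler_pMn2r _ 2) //.
  apply: (@le_trans _ _ (\sum_(u <- s) \sum_(v <- s | v != u)
      (k u v * `|z u| ^+ 2 + k v u * `|z v| ^+ 2))).
    apply: (@le_trans _ _ ((\sum_(u <- s) \sum_(v <- s | v != u)
        `|z u| * `|z v| * `|H u v|) *+ 2)).
      rewrite lerMn2r /=; apply: le_trans (ler_norm_sum _ _ _) _.
      apply: ler_sum => u _; apply: le_trans (ler_norm_sum _ _ _) _.
      by apply: ler_sum => v _; rewrite !normrM norm_conjC.
    rewrite -sumrMnl big_seq [leRHS]big_seq; apply: ler_sum => u us'.
    rewrite -sumrMnl big_seq_cond [leRHS]big_seq_cond; apply: ler_sum => v /andP[vs vu].
    by apply: amgm => //; apply: Hk => //; rewrite eq_sym.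
  rewrite (eq_bigr _ (fun u _ => big_split _ _ _ _ _)) big_split /= mulr2n.
  have -> : \sum_(u <- s) \sum_(v <- s | v != u) k v u * `|z v| ^+ 2 =
            \sum_(u <- s) \sum_(v <- s | v != u) k u v * `|z u| ^+ 2.
    rewrite (exchange_big_dep predT) //=; apply: eq_bigr => u _.
    by apply: eq_bigl => v; rewrite eq_sym.
  rewrite /M lerD //; apply: ler_sum => u _; rewrite mulr_sumr;
    by apply: ler_sum => v _; rewrite mulrC.
have MP : M < P.
  rewrite /M /P; case: s us s0 z0 Hk HD {Hu0 Pr PRr Rr RM M P R} => // u s us _ z0 _ HD.
  rewrite -subr_gt0 -sumrB big_cons ltr_pwDl //.
    rewrite -mulrBr mulr_gt0 ?exprn_gt0 ?normr_gt0 ?z0 ?mem_head //.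
    by rewrite subr_gt0 HD ?mem_head.
  rewrite big_seq; apply: sumr_ge0 => v vs.
  rewrite -mulrBr mulr_ge0 ?exprn_ge0 // subr_ge0 ltW // HD //.
  by rewrite inE vs orbT.
have := le_lt_trans RM MP; rewrite real_ltr_norml // => /andP[+ _].
by rewrite -subr_gt0 opprK addrC.
Qed.

Lemma sum_geometric N : \sum_(0 <= n < N) (2 ^+ n.+1)^-1 <= 1 :> C.
Proof.
suff -> : \sum_(0 <= n < N) (2 ^+ n.+1)^-1 = 1 - (2 ^+ N)^-1 :> C.
  by rewrite gerBl invr_ge0 exprn_ge0.
elim: N => [|N IH]; first by rewrite big_nil expr0 invr1 subrr.
rewrite big_nat_recr //= IH exprS invfM.
by rewrite -{1}[(2 ^+ N)^-1]mul1r; field; rewrite expf_neq0 //= pnatr_eq0.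
Qed.

(** A sum over distinct elements of s indexed injectively by natural numbers is
    bounded, for nonnegative terms, by the sum over all natural numbers below N. *)
Lemma sum_inj_le (I : eqType) (s : seq I) (r : I -> nat) (g : nat -> C) N :
  injective r -> uniq s -> (forall n, 0 <= g n) ->
  \sum_(v <- s | (r v < N)%N) g (r v) <= \sum_(0 <= n < N) g n.
Proof.
move=> rI us g0; rewrite -(big_map r (fun n => (n < N)%N) g) -big_filter.
rewrite (perm_big [seq n <- index_iota 0 N | n \in map r s]).
  rewrite big_filter big_mkcond; apply: ler_sum => n _; by case: ifP.
apply: uniq_perm; rewrite ?filter_uniq ?iota_uniq ?map_inj_uniq //.
by move=> n; rewrite !mem_filter mem_index_iota andbC.
Qed.

End Dominance.

(** * A faithful positive functional *)

Section HermitianPart.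
Variables (C : numClosedFieldType) (A : starAlgType C) (L : A -> C).

(** Twice the hermitian part of a functional L. *)
Definition herm_part a : C := L a + (L (star a))^*.

Lemma herm_partD : (forall a b, L (a + b) = L a + L b) ->
  forall a b, herm_part (a + b) = herm_part a + herm_part b.
Proof. by move=> LD a b; rewrite /herm_part starD !LD rmorphD addrACA. Qed.

Lemma herm_partZ : (forall c a, L (cscale c a) = c * L a) ->
  forall c a, herm_part (cscale c a) = c * herm_part a.
Proof.
move=> LZ c a; rewrite /herm_part starZ !LZ rmorphM mulrDr.
by congr (_ + _ * _); apply: conjCK.
Qed.

Lemma herm_part_star a : herm_part (star a) = (herm_part a)^*.
Proof.
rewrite /herm_part starK rmorphD addrC; congr (_ + _); exact: (esym (conjCK _)).
Qed.

End HermitianPart.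

Section Functional.
Variables (C : numClosedFieldType) (m : nat) (le : rel (gen m)).
Hypothesis le_lin : linear_order le.
Local Notation F := (free_star C m).
Local Notation rank := (rank le).
Implicit Types (f g h : F) (u v w x : word m) (c : C) (a b : word m -> C).

Variable S : set F.
Hypothesis sneS : strictly_non_expanding le S.
Let clS := ne_closed sneS.
Local Notation I := (ideal_gen S).
Local Notation RS := (RS le S).
Local Notation BW := (BW le S).

(** The first half of a word; it is w on the word w w^*, see [half_square]. *)
Definition half x : word m := FMonom (take (size x)./2 x).

(** The weight a w on the words w w^*, and 0 on the other words. *)
Definition square_weight a x : C :=
  if x == (half x * word_star (half x))%M then a (half x) else 0.

Lemma half_square u : half (u * word_star u)%M = u.
Proof.
apply: word_inj; set x := (u * _)%M.
rewrite -[LHS]/(take (size (seq_of_word x))./2 (seq_of_word x)).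
rewrite word_mulE size_cat /=.
by rewrite size_rev size_map addnn doubleK take_size_cat.
Qed.

Lemma square_weightE a u : square_weight a (u * word_star u)%M = a u.
Proof. by rewrite /square_weight half_square eqxx. Qed.

Definition square_sum a f : C := \sum_(x <- msupp f) f@_x * square_weight a x.

Lemma square_sumD a f g : square_sum a (f + g) = square_sum a f + square_sum a g.
Proof. exact: (@mmapD (word m) C C idfun (square_weight a)). Qed.

Lemma square_sumZ a c f : square_sum a (c *: f) = c * square_sum a f.
Proof.
apply: etrans (@mmapEw (word m) C C idfun (square_weight a) _ _ (msuppZ_le c f)) _.
by rewrite mulr_sumr; apply: eq_bigr => x _; rewrite mulrA; congr (_ * _); apply: fcoefZ.
Qed.

Lemma square_sum_mon a x : square_sum a (mon C x) = square_weight a x.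
Proof.
apply: etrans (@mmapU (word m) C C idfun (square_weight a) 1 x) _.
by rewrite mul1r.
Qed.

Lemma eq_square_sum a b f : (forall w, f@_(w * word_star w)%M != 0 -> a w = b w) ->
  square_sum a f = square_sum b f.
Proof.
move=> ab; apply: eq_big_seq => x; rewrite mem_msupp /square_weight => fx.
by case: eqP => // e; rewrite ab // -e.
Qed.

Lemma square_sum_RSD a f g :
  square_sum a (RS (f + g)) = square_sum a (RS f) + square_sum a (RS g).
Proof. by rewrite (RSD le_lin clS) square_sumD. Qed.

Lemma square_sum_RSZ a c f : square_sum a (RS (c *: f)) = c * square_sum a (RS f).
Proof. by rewrite (RSZ le_lin clS) square_sumZ. Qed.

(** The functional f |-> L f + conj (L (f^* )) on the free algebra, where L reads
    the weighted sum of the squares w w^* off the normal form. *)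
Definition functional a : F -> C := herm_part (fun f => square_sum a (RS f)).

Lemma functionalD a f g : functional a (f + g) = functional a f + functional a g.
Proof. exact: herm_partD (square_sum_RSD a) f g. Qed.

Lemma functionalZ a c f : functional a (c *: f) = c * functional a f.
Proof. exact: herm_partZ (square_sum_RSZ a) c f. Qed.

Lemma functional0 a : functional a 0 = 0.
Proof. by rewrite -(scale0r 0) functionalZ mul0r. Qed.

Lemma functional_sum a (J : Type) (r : seq J) (G : J -> F) :
  functional a (\sum_(i <- r) G i) = \sum_(i <- r) functional a (G i).
Proof. exact: (big_morph _ (functionalD a) (functional0 a)). Qed.

Lemma functional_star a f : functional a (star f) = (functional a f)^*.
Proof. exact: herm_part_star. Qed.

Lemma functional_ideal a f : I f -> functional a f = 0.
Proof.
move=> If; rewrite /functional /herm_part !(RS_ideal le_lin clS) //; last first.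
  exact: ne_symmetric sneS _ If.
by rewrite (_ : square_sum a 0 = 0) ?conjC0 ?addr0 // -(scale0r 0) square_sumZ mul0r.
Qed.

(** The Gram matrix of the words for the functional of weights a. *)
Definition gram a u v : C := functional a (mon C (u * word_star v)%M).

Lemma gramC a u v : gram a v u = (gram a u v)^*.
Proof.
rewrite /gram -functional_star star_mon.
by rewrite word_starM word_starK.
Qed.

Lemma gram_diag a u : BW u -> gram a u u = a u + (a u)^*.
Proof.
move=> Bu; rewrite /gram /functional /herm_part star_mon word_starM word_starK.
by rewrite !(RS_id le_lin clS) ?square_sum_mon ?square_weightE //;
   apply/spanBW_mon/(sne_strict sneS).
Qed.

(** The word w is a subword of w w^*. *)
Lemma BW_square w : BW (w * word_star w)%M -> BW w.
Proof.
move=> Bw s Ss; apply: contra (Bw s Ss) => /infixP[p [q e]].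
by apply/infixP; exists p, (q ++ word_star w); rewrite word_mulE e !catA.
Qed.

(** The non-expanding condition: an off-diagonal entry at (u, v) only depends on
    the weights of the words smaller than sup(u, v). *)
Lemma eq_gram a b u v : BW u -> BW v -> u != v ->
    (forall w, (rank w < maxn (rank u) (rank v))%N -> a w = b w) ->
  gram a u v = gram b u v.
Proof.
move=> Bu Bv uv ab; rewrite /gram /functional /herm_part star_mon word_starM word_starK.
have H x y : BW x -> BW y -> x != y ->
    (forall w, (rank w < maxn (rank x) (rank y))%N -> a w = b w) ->
    square_sum a (RS (mon C (x * word_star y)%M)) =
    square_sum b (RS (mon C (x * word_star y)%M)).
  move=> Bx By xy abxy; apply: eq_square_sum => w nz; apply: abxy.
  have [sB _] := RSP le_lin clS (mon C (x * word_star y)%M).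
  have := ne_lt sneS Bx By (BW_square (sB _ nz)) xy nz.
  by rewrite word_ltE // word_supE.
have e1 := H u v Bu Bv uv ab.
have e2 : square_sum a (RS (mon C (v * word_star u)%M)) =
          square_sum b (RS (mon C (v * word_star u)%M)).
  by apply: H => //; [rewrite eq_sym | rewrite maxnC].
exact: (f_equal2 (fun p q : C => p + q^*) e1 e2).
Qed.

(** The word of rank n, if any, and the empty word otherwise. *)
Definition unrank n : word m := xget 1%M [set w | rank w = n].

Lemma rankK : cancel rank unrank.
Proof.
move=> w; rewrite /unrank; case: xgetP => [x _ /(rank_inj le_lin)//|/(_ w)[]//].
Qed.

(** Weights satisfying a recursive equation: a u exceeds by 2 the sum, over the
    words v smaller than u, of |gram v u|^2 2^(rank u + 1).  The entries are
    computed with the weights truncated to 0 from rank u on, which by [eq_gram]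
    does not change the relevant ones.  The indices n that are not ranks
    contribute a nonnegative junk term. *)
Definition dominating a : Prop := forall u,
  2 + \sum_(0 <= n < rank u)
        `|gram (fun w => if (rank w < rank u)%N then a w else 0) (unrank n) u| ^+ 2
          * 2 ^+ (rank u).+1 = a u.

Lemma dominating_exists : exists a, dominating a.
Proof.
pose Phi N (t : nat -> C) : C := 2 + \sum_(0 <= n < N)
  `|gram (t \o rank) (unrank n) (unrank N)| ^+ 2 * 2 ^+ N.+1.
have [alpha alphaE] := strong_recursion 0 Phi.
by exists (alpha \o rank) => u; rewrite /= alphaE /Phi rankK.
Qed.

Section Positivity.
Variable a : word m -> C.
Hypothesis dom_a : dominating a.

Lemma dominating_ge2 u : 2 <= a u.
Proof.
by rewrite -dom_a lerDl; apply: sumr_ge0 => n _; rewrite mulr_ge0 ?exprn_ge0.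
Qed.

Lemma dominating_gram_diag u : BW u -> gram a u u = a u *+ 2.
Proof.
move=> Bu; rewrite gram_diag // (_ : (a u)^* = a u) //.
by apply/CrealP/ger0_real/le_trans/dominating_ge2; rewrite ler0n.
Qed.

(** The weights of [diagonal_dominance].  For u smaller than v, the entry
    (u, v) costs u the amount 2^-(rank v + 1), of sum at most 1 over all v, and
    costs v the amount |gram u v|^2 2^(rank v + 1), which a v is chosen to
    outweigh. *)
Definition pair_weight u v : C :=
  if (rank u < rank v)%N then (2 ^+ (rank v).+1)^-1
  else `|gram a v u| ^+ 2 * 2 ^+ (rank u).+1.

Lemma gram_le_pair_weight u v : u != v ->
  `|gram a u v| ^+ 2 <= pair_weight u v * pair_weight v u.
Proof.
have p2 n : (2 ^+ n : C) != 0 by rewrite expf_neq0 // pnatr_eq0.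
move=> uv; rewrite /pair_weight; case: (ltngtP (rank u) (rank v)) => [_|_|/(rank_inj le_lin)/eqP].
- by rewrite mulrC mulfK.
- by rewrite (gramC a u v) norm_conjC mulfK.
- by rewrite (negPf uv).
Qed.

Lemma pair_weight_ge0 u v : 0 <= pair_weight u v.
Proof. by rewrite /pair_weight; case: ifP => _; rewrite ?invr_ge0 ?mulr_ge0 ?exprn_ge0. Qed.

(** The row sum at u is at most 1, from the words greater than u, plus a u - 2,
    from the smaller ones, whereas the diagonal entry is 2 a u. *)
Lemma sum_pair_weight_lt s u : uniq s -> {in s, forall v, BW v} -> u \in s ->
  \sum_(v <- s | v != u) pair_weight u v < gram a u u.
Proof.
move=> us sB su; rewrite dominating_gram_diag; last exact: sB.
have a0 : 0 < a u by apply: lt_le_trans (dominating_ge2 u); rewrite ltr0n.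
apply: (@le_lt_trans _ _ (1 + (a u - 2))); last first.
  rewrite mulr2n addrCA ltrD2l; apply: lt_trans (_ : 0 < _) => //.
  by rewrite [1 - 2](_ : _ = -1) ?oppr_lt0 ?ltr01 //; ring.
rewrite (bigID (fun v => (rank u < rank v)%N)) /=; apply: lerD.
  (* words greater than u: part of a geometric sum, N bounding the ranks in s *)
  pose N := (\max_(v <- s) (rank v).+1)%N.
  apply: le_trans (sum_geometric C N).
  apply: le_trans (sum_inj_le N (rank_inj le_lin) us _); last first.
    by move=> n; rewrite invr_ge0 exprn_ge0.
  rewrite big_seq_cond [leRHS]big_seq_cond [leLHS]big_mkcond [leRHS]big_mkcond /=.
  apply: ler_sum => v _; case: ifP => [/and3P[sv _ uv]|_].
    by rewrite sv (_ : (rank v < N)%N) /pair_weight ?uv //; apply: leq_bigmax_seq.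
  by case: ifP => // _; rewrite invr_ge0 exprn_ge0.
(* words smaller than u: part of the sum defining a u *)
rewrite -(dom_a u) [2 + _]addrC addrK.
pose g n : C := `|gram (fun w => if (rank w < rank u)%N then a w else 0) (unrank n) u| ^+ 2
          * 2 ^+ (rank u).+1.
have g0 n : 0 <= g n by rewrite mulr_ge0 ?exprn_ge0.
apply: le_trans (sum_inj_le (rank u) (rank_inj le_lin) us g0).
rewrite big_seq_cond [leRHS]big_seq_cond.
rewrite le_eqVlt; apply/orP; left; apply/eqP; apply: eq_big => v.
  rewrite -leqNgt ltn_neqAle; case: (v \in s) => //=; congr (_ && _).
  by rewrite (inj_eq (rank_inj le_lin)).
case/and3P=> sv vu; rewrite -leqNgt => rvu; rewrite /pair_weight /g rankK ltnNge rvu /=.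
congr (`|_| ^+ 2 * _); apply: eq_gram; [exact: sB | exact: sB | exact: vu |] => w.
by rewrite (maxn_idPr rvu) => ->.
Qed.

Lemma functional_gram f g : functional a (f * star g) =
  \sum_(u <- msupp f) \sum_(v <- msupp g) f@_u * (g@_v)^* * gram a u v.
Proof.
rewrite {1}(mon_sum f) mulr_suml functional_sum; apply: eq_bigr => u _.
rewrite -fscaleAl functionalZ.
rewrite {1}(mon_sum g) (_ : star _ = \sum_(v <- msupp g) (g@_v)^* *: mon C (word_star v)).
  rewrite mulr_sumr functional_sum mulr_sumr; apply: eq_bigr => v _.
  by rewrite -fscaleAr functionalZ mulrA monM.
apply: etrans (@fstar_sum C m _ _ _) _; apply: eq_bigr => v _.
by apply: etrans (@starZ C F _ _) _; rewrite star_mon.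
Qed.

Lemma functional_gt0_nf f : spanBW le S f -> f != 0 -> 0 < functional a (f * star f).
Proof.
move=> Bf f0; have Qr : functional a (f * star f) \is Num.real.
  by rewrite CrealE -functional_star starM starK.
move: Qr; rewrite functional_gram => Qr.
have sB : {in msupp f, forall v, BW v} by move=> v; rewrite mem_msupp; apply: Bf.
apply: (@diagonal_dominance C _ (msupp f) (gram a) pair_weight (fun u => f@_u)) => //.
- apply: contra f0 => /eqP s0; apply/eqP.
  by rewrite (mon_sum f) s0 big_nil.
- by move=> u; rewrite mem_msupp.
- exact: pair_weight_ge0.
- by move=> u v _ _; apply: gram_le_pair_weight.
- by move=> u su; apply: (sum_pair_weight_lt (fset_uniq _) sB su).
Qed.

Lemma functional_gt0 f : ~ I f -> 0 < functional a (f * star f).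
Proof.
move=> nIf; have [Br Ir] := RSP le_lin clS f.
have -> : functional a (f * star f) = functional a (RS f * star (RS f)).
  have sI : I (star (f - RS f)) by apply: (ne_symmetric sneS).
  apply/eqP; rewrite -subr_eq0 -[- functional _ _]mulN1r -functionalZ -functionalD.
  rewrite scaleN1r; apply/eqP; apply: functional_ideal.
  have tI := ideal_gen_tsi S.
  rewrite (_ : _ - _ = (f - RS f) * star f + RS f * star (f - RS f)).
    by apply: ideal_genD; [apply: (tsiMr tI) | apply: (tsiMl tI)].
  by rewrite starB mulrBl mulrBr addrA subrK.
apply: functional_gt0_nf => //; apply: contra_notN nIf => /eqP r0.
by rewrite r0 subr0 in Ir.
Qed.

End Positivity.
End Functional.

(** The functional descends to the quotient, where it is computed on
    representatives. *)
Lemma quotient_representation (C : numClosedFieldType) (m : nat) (le : rel (gen m))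
    (S : set (free_star C m)) (hS : strictly_non_expanding le S) :
  linear_order le ->
  let Q := star_quot (sym_star_ideal (ne_symmetric hS)) in
  exists (E : lmodType C) (ip : {dot E for conjC}) (rho : Q -> adjop ip),
    is_star_morphism rho /\ injective rho.
Proof.
move=> le_lin Q; have [a dom_a] := dominating_exists le_lin S.
pose pi : free_star C m -> Q := @quot_pi _ _ _.
have [piD piZ piM _ pi_star] := quot_pi_star_morphism (sym_star_ideal (ne_symmetric hS)).
have pi_surj (q : Q) : exists f, pi f = q.
  by eexists; apply: quot_piK.
pose r (q : Q) := xget 0 [set f | pi f = q].
have rK q : pi (r q) = q.
  by have [f fq] := pi_surj q; rewrite /r; case: xgetP => // /(_ f)[].
pose T q := functional le S a (r q).
have T_pi f : T (pi f) = functional le S a f.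
  have /quot_piP I0 : pi (r (pi f)) = pi f by rewrite rK.
  rewrite /T -[r _](subrK f) functionalD // (functional_ideal le_lin hS) ?add0r //.
pose E := gns_space Q; exists E.
apply: (@gns_representation C Q T).
- by move=> p q; rewrite -(rK p) -(rK q) -[_ + _]piD !T_pi functionalD.
- by move=> c q; rewrite -(rK q) -[cscale _ _]piZ !T_pi [LHS]functionalZ.
- by move=> q; rewrite -(rK q) -[star _]pi_star !T_pi functional_star.
- move=> q q0; rewrite -(rK q) -[star _]pi_star -[_ * _]piM T_pi.
  apply: functional_gt0 => // Iq; case/eqP: q0; rewrite -(rK q).
  by apply/quot_piP; rewrite subr0.
Qed.

Unset Implicit Arguments.

Theorem corollary1 (R : realType) (A : starAlgType R[i])
    (hA : strictly_non_expanding_algebra A) :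
  exists (E : lmodType R[i]) (ip : {dot E for conjC}) (rho : A -> adjop ip),
    is_star_morphism rho /\ injective rho.
Proof.
have [m [le [S [hS [le_lin [f [fD fZ fM f1 f_star] /bij_inj f_inj]]]]]] := hA.
have [E [ip [rho [[rD rZ rM r1 r_star] rho_inj]]]] := quotient_representation hS le_lin.
exists E, ip, (rho \o f); split; last exact: inj_comp.
split=> [x y|c x|x y||x] /=.
- by rewrite fD rD.
- by rewrite fZ rZ.
- by rewrite fM rM.
- by rewrite f1 r1.
- by rewrite f_star r_star.
Qed.
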